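(* Let $\mathscr{H}$ be a complex Hilbert space, $d\ge1$, and let $\mathbf{A}=(A_1,\ldots,A_d)\in\mathbb{B}^d(\mathscr{H})$. Then $$w_e(\mathbf{A})\le\sqrt{\frac12\left\||\mathbf{A}^*|^{2(1-t)}\right\|\left\||\mathbf{A}|^{2t}\right\|+\frac{\sqrt d}{2}w_e\left(|\mathbf{A}|^{2t}|\mathbf{A}^*|^{2(1-t)}\right)}$$ $$=\sqrt{\frac12\sqrt{\left\|\sum_{k=1}^d|A_k^*|^{4(1-t)}\right\|}\sqrt{\left\|\sum_{k=1}^d|A_k|^{4t}\right\|}+\frac{\sqrt d}{2}w_e\left(|\mathbf{A}|^{2t}|\mathbf{A}^*|^{2(1-t)}\right)}$$ for all $t$, $0\le t\le1$. In particular, $$w_e(\mathbf{A})\le\sqrt{\frac12\|\mathbf{A}^*\|\|\mathbf{A}\|+\frac{\sqrt d}{2}w_e\left(|\mathbf{A}||\mathbf{A}^*|\right)}=\sqrt{\frac12\sqrt{\left\|\sum_{k=1}^d|A_k^*|^{2}\right\|}\sqrt{\left\|\sum_{k=1}^d|A_k|^{2}\right\|}+\frac{\sqrt d}{2}w_e\left(|\mathbf{A}||\mathbf{A}^*|\right)}.$$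
   Context: $\mathbb{B}(\mathscr{H})$ is the algebra of bounded linear operators on the complex Hilbert space $\mathscr{H}$, and $\mathbb{B}^d(\mathscr{H})$ is the set of $d$-tuples of such operators. For $T\in\mathbb{B}(\mathscr{H})$, $|T|=(T^*T)^{1/2}$, $|T|^0=I$ (identity operator), and $\|T\|$ is the operator norm. For $\mathbf{T}=(T_1,\ldots,T_d)$, the Euclidean operator radius is $w_e(\mathbf{T})=\sup\{(\sum_{k=1}^d|\langle T_kx,x\rangle|^2)^{1/2}:\|x\|=1\}$ and the Euclidean operator norm is $\|\mathbf{T}\|=\sup\{(\sum_{k=1}^d\|T_kx\|^2)^{1/2}:\|x\|=1\}$. Operations on tuples are componentwise: $\mathbf{A}^*=(A_1^*,\ldots,A_d^* )$, $|\mathbf{A}|^s=(|A_1|^s,\ldots,|A_d|^s)$, $|\mathbf{A}^*|^s=(|A_1^*|^s,\ldots,|A_d^*|^s)$, and products are componentwise. *)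

(* Defs.v *)
From HB Require Import structures.
From mathcomp Require Import all_boot all_order all_algebra.
From mathcomp Require Import sesquilinear complex.
From mathcomp Require Import all_classical all_reals all_analysis.

Set Implicit Arguments.
Unset Strict Implicit.
Unset Printing Implicit Defensive.

Import Order.TTheory GRing.Theory Num.Theory.
Import numFieldNormedType.Exports.

Local Open Scope classical_set_scope.
Local Open Scope complex_scope.
Local Open Scope ring_scope.

Section BoundedOperators.
Context {R : realType} {H : normedModType R[i]}.

Definition bounded_op_prop (f : H -> H) : Prop :=
  linear f /\ exists M : R[i], forall x, `|f x| <= M * `|x|.

Definition bounded_op_pred : {pred H -> H} := [pred f | `[< bounded_op_prop f >]].

Lemma bounded_opP f : reflect (bounded_op_prop f) (f \in bounded_op_pred).
Proof. exact: asboolP. Qed.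

Lemma bounded_op_submod : submod_closed bounded_op_pred.
Proof.
split=> [|a f g /bounded_opP [lf [M fM]] /bounded_opP [lg [N gN]]].
  apply/bounded_opP; split=> [b x y|]; first by rewrite scaler0 addr0.
  by exists 0 => x; rewrite normr0 mul0r.
apply/bounded_opP; split=> [b x y|].
  change (a *: f (b *: x + y) + g (b *: x + y)
    = b *: (a *: f x + g x) + (a *: f y + g y)).
  by rewrite lf lg !scalerDr !scalerA (mulrC b a) !addrA; congr (_ + _);
     rewrite -!addrA; congr (_ + _); rewrite addrC.
exists (`|a| * M + N) => x; rewrite mulrDl -mulrA.
change (`|a *: f x + g x| <= `|a| * (M * `|x|) + N * `|x|).
apply: le_trans (ler_normD _ _) _; apply: lerD => //.
by rewrite normrZ ler_wpM2l.
Qed.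

HB.instance Definition _ :=
  GRing.isSubmodClosed.Build _ _ bounded_op_pred bounded_op_submod.

Record bounded_op := BoundedOp {
  bop_fun :> H -> H;
  bop_funP : bop_fun \in bounded_op_pred }.

HB.instance Definition _ := [isSub for bop_fun].
HB.instance Definition _ := [Choice of bounded_op by <:].
HB.instance Definition _ := [SubChoice_isSubLmodule of bounded_op by <:].

Implicit Types S T : bounded_op.

Lemma bopP S T : (forall x, S x = T x) -> S = T.
Proof. by move=> ST; apply: val_inj; apply/funext. Qed.

Lemma bop_linear T : linear T.
Proof. by have /bounded_opP[] := bop_funP T. Qed.

Lemma bop_bounded T : exists M : R[i], forall x, `|T x| <= M * `|x|.
Proof. by have /bounded_opP[] := bop_funP T. Qed.

Lemma bop_id_subproof : (@id H) \in bounded_op_pred.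
Proof. by apply/bounded_opP; split=> //; exists 1 => x; rewrite mul1r. Qed.

Definition bop_id := BoundedOp bop_id_subproof.

Lemma bop_comp_subproof S T : (S \o T) \in bounded_op_pred.
Proof.
apply/bounded_opP; split=> [a x y|] /=; first by rewrite !bop_linear.
have [[M SM] [N TN]] := (bop_bounded S, bop_bounded T).
exists (`|M| * N) => x /=; apply: (le_trans (SM _)).
apply: (@le_trans _ _ (`|M| * `|T x|)).
  have [x0|xn] := eqVneq (`|T x|) 0; first by rewrite x0 !mulr0.
  have xp : 0 < `|T x| by rewrite lt_def xn normr_ge0.
  have Mr : 0 <= M by rewrite -(pmulr_lge0 _ xp) (le_trans _ (SM _)).
  by rewrite ger0_norm.
by rewrite -mulrA ler_wpM2l.
Qed.

Definition bop_comp S T := BoundedOp (bop_comp_subproof S T).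

Lemma bop_compA : associative bop_comp. Proof. by move=> *; exact: bopP. Qed.
Lemma bop_comp1l : left_id bop_id bop_comp. Proof. by move=> *; exact: bopP. Qed.
Lemma bop_comp1r : right_id bop_id bop_comp. Proof. by move=> *; exact: bopP. Qed.
Lemma bop_compDl : left_distributive bop_comp +%R.
Proof. by move=> S T U; apply: bopP. Qed.
Lemma bop_compDr : right_distributive bop_comp +%R.
Proof.
move=> S T U; apply: bopP => x /=.
by have := bop_linear S 1 (T x) (U x); rewrite !scale1r.
Qed.

(* Only a possibly trivial ring, as H may be the zero space. *)
HB.instance Definition _ := GRing.Zmodule_isPzRing.Build bounded_op
  bop_compA bop_comp1l bop_comp1r bop_compDl bop_compDr.

End BoundedOperators.

Arguments bounded_op {R} H.
Notation "''B' ( H )" := (bounded_op H)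
  (at level 8, H at level 200, format "''B' ( H )") : type_scope.

Section Norms.
Context {R : realType} {H : normedModType R[i]}.

(* The norms of [H] and of [R[i]] itself take values in [R[i]]. *)
Definition normR {V : normedZmodType R[i]} (x : V) : R := complex.Re `|x|.

(* [sup set0 = 0], so the three suprema below are 0 on the zero space. *)
Definition op_norm (T : 'B(H)) : R :=
  sup [set normR (T x) | x in [set x | `|x| = 1]].

Definition euclidean_op_norm d (A : 'I_d -> 'B(H)) : R :=
  sup [set Num.sqrt (\sum_(k < d) normR (A k x) ^+ 2) | x in [set x | `|x| = 1]].

Definition euclidean_op_radius (dot : {dot H for Num.conj}) d
    (A : 'I_d -> 'B(H)) : R :=
  sup [set Num.sqrt (\sum_(k < d) normR (dot (A k x) x) ^+ 2)
      | x in [set x | `|x| = 1]].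

End Norms.

Section FunctionalCalculus.
Context {R : realType} {H : normedModType R[i]}.
Implicit Types S T : 'B(H).

Definition spectrum T : set R[i] :=
  [set l : R[i] | ~ exists S, (T - l *: (1 : 'B(H))) * S = 1 /\ S * (T - l *: (1 : 'B(H))) = 1].

Definition op_poly (p : {poly R}) T : 'B(H) :=
  \sum_(i < size p) (p`_i)%:C *: T ^+ i.

(* Continuous functional calculus of a self-adjoint operator [T], whose spectrum
   is real: [S = f(T)] is the operator norm limit of [p_n(T)] whenever the
   polynomials [p_n] converge to [f] uniformly on the spectrum of [T]. *)
Definition is_fcalc T (f : R -> R) S : Prop :=
  forall p : nat -> {poly R},
    {uniform [set x : R | spectrum T x%:C],
      (fun n x => (p n).[x]) @ \oo --> f} ->
    (fun n => op_norm (op_poly (p n) T - S)) @ \oo --> (0 : R).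

Definition fcalc T (f : R -> R) : 'B(H) := xget 0 [set S | is_fcalc T f S].

(* Meant for positive [T] and [s >= 0]; since [0 `^ 0 = 1],
   [op_pow T 0] is the identity. *)
Definition op_pow T (s : R) : 'B(H) := fcalc T (fun x => x `^ s).

End FunctionalCalculus.

Section Adjoint.
Context {R : realType} {H : normedModType R[i]} (dot : {dot H for Num.conj}).

Definition op_adj (T : 'B(H)) : 'B(H) :=
  xget 0 [set S : 'B(H) | forall x y, dot (T x) y = dot x (S y)].

Definition op_abs (T : 'B(H)) : 'B(H) := op_pow (op_adj T * T) 2^-1.

Definition tuple_adj d (A : 'I_d -> 'B(H)) : 'I_d -> 'B(H) :=
  fun k => op_adj (A k).

Definition tuple_abs d (A : 'I_d -> 'B(H)) : 'I_d -> 'B(H) :=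
  fun k => op_abs (A k).

End Adjoint.

Definition tuple_pow {R : realType} {H : normedModType R[i]} d
    (A : 'I_d -> 'B(H)) (s : R) : 'I_d -> 'B(H) :=
  fun k => op_pow (A k) s.

(* Main.v *)
Require Import Defs.
From HB Require Import structures.
From mathcomp Require Import all_boot all_order all_algebra.
From mathcomp Require Import sesquilinear complex.
From mathcomp Require Import all_classical all_reals all_analysis.
From mathcomp Require Import ring lra.

Set Implicit Arguments.
Unset Strict Implicit.
Unset Printing Implicit Defensive.

Import Order.TTheory GRing.Theory Num.Theory.
Import numFieldNormedType.Exports.

Local Open Scope classical_set_scope.
Local Open Scope complex_scope.
Local Open Scope ring_scope.

(** Write P = A^* A and Q = A A^*, so that |A|^(2t) = P^t and
    |A^*|^(2(1-t)) = Q^(1-t).  Everything rests on Kato's mixed Schwarz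
    inequality

      |<A x, x>|^2 <= <P^t x, x> <Q^(1-t) x, x>        ([mixed_schwarz_dot]).

    For a unit vector x, Buzano's refinement of Cauchy-Schwarz ([buzano])
    bounds the right-hand side by half of
    |P^t x| |Q^(1-t) x| + |<P^t Q^(1-t) x, x>|.  Summing over the entries of the
    tuple and applying Cauchy-Schwarz in R^d to both sums, the second one against
    the constant sequence 1 (whence sqrt d), gives the inequality for w_e
    ([euclidean_op_radius_bound]).  The other form of the bound holds because
    the sum over k of |B_k x|^2 is <G x, x> for the positive operator
    G = sum of the B_k^* B_k, whose norm is the supremum of its quadratic
    form ([euclidean_op_norm_gram]).  The particular case is t = 1/2.

    Mixed Schwarz is proved without polar decomposition.  For e > 0 the operator
    U = P^t + e is positive with inverse V = (P^t + e)^(-1), so Cauchy-Schwarz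
    for the form of U gives
    <A x, y>^2 = <U x, V A^* y>^2 <= <U x, x> <V A^* y, A^* y>.  Since
    A f(P) = f(Q) A, the last factor is <(Q^t + e)^(-1) Q y, y>, and
    r / (r^t + e) <= r^(1-t) bounds it by <Q^(1-t) y, y>; then e tends to 0.

    This needs the continuous functional calculus of a positive operator T with
    |T| <= M.  The key estimate is |p(T)| <= sup |p| over the real spectrum
    ([op_poly_bound]).  With N = |p(T)|, the operator p(T)^2 - N^2 is not bounded
    below; factoring p^2 - N^2 over the complex numbers, some factor T - mu is
    not bounded below, which forces mu to be a real point of the spectrum where
    |p(mu)| = N.  Lax-Milgram ([lax_milgram]) places the real spectrum inside
    [0, M] and also provides adjoints.  By Weierstrass approximation on [0, M]
    the calculus therefore extends to continuous functions, and it is convenient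
    to phrase it as approximability on [0, M] ([icalc]), a relation that
    determines the functional calculus ([icalc_fcalc]).

    Since adjointness, positivity and norms only involve the real part [ip] of
    the inner product, most arguments take place in the underlying real
    Hilbert space. *)

(** * Weierstrass approximation *)

Section Weierstrass.
Context {R : realType}.
Implicit Types (f : R -> R) (x y e M : R) (n k : nat).

(** The Bernstein polynomial of [phi], as the expectation of [phi (S_n)] for a
    sum of [n] Bernoulli trials of parameter [X], conditioning on the first one.
    The recursion spares all binomial identities. *)
Fixpoint bernstein n (phi : nat -> R) : {poly R} :=
  if n is m.+1 then
    'X * bernstein m (phi \o succn) + (1 - 'X) * bernstein m phi
  else (phi 0)%:P.

Lemma bernstein_horner n phi x : (bernstein n.+1 phi).[x] =
  x * (bernstein n (phi \o succn)).[x] + (1 - x) * (bernstein n phi).[x].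
Proof. by rewrite /= !hornerE. Qed.

Lemma bernstein_lin n a b phi psi x :
  (bernstein n (fun k => a * phi k + b * psi k)).[x] =
  a * (bernstein n phi).[x] + b * (bernstein n psi).[x].
Proof.
elim: n phi psi => [|n IH] phi psi; first by rewrite /= !hornerE.
rewrite !bernstein_horner IH.
rewrite -[X in bernstein n X]/(fun k =>
  a * (phi \o succn) k + b * (psi \o succn) k) IH; ring.
Qed.

Lemma bernstein_cst n a x : (bernstein n (fun=> a)).[x] = a.
Proof. elim: n => [|n IH]; rewrite ?bernstein_horner ?IH /= ?hornerE //; ring. Qed.

Lemma bernstein_le n phi psi x : 0 <= x <= 1 ->
  (forall k, (k <= n)%N -> phi k <= psi k) ->
  (bernstein n phi).[x] <= (bernstein n psi).[x].
Proof.
move=> /andP[x0 x1]; elim: n phi psi => [|n IH] phi psi le_phi_psi.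
  by rewrite /= !hornerE le_phi_psi.
rewrite !bernstein_horner lerD // ler_wpM2l ?subr_ge0 //; apply: IH => k kn.
  exact: le_phi_psi.
by apply: le_phi_psi; rewrite leqW.
Qed.

(** Variance plus squared bias of [S_n] around [c]. *)
Lemma bernstein_moment2 n c x : (bernstein n (fun k => (k%:R - c) ^+ 2)).[x] =
  n%:R * x * (1 - x) + (n%:R * x - c) ^+ 2.
Proof.
elim: n c => [|n IH] c; first by rewrite /= hornerE; ring.
rewrite bernstein_horner IH; set u := _ \o _.
have -> : u = fun k => (k%:R - (c - 1)) ^+ 2.
  by apply/funext => k; rewrite /u /= -natr1; ring.
rewrite IH -natr1; ring.
Qed.

(** Uniform continuity in the form that suits a second-moment estimate: where
    [x] and [y] are far apart, [C (x - y)^2] exceeds the oscillation of [f]. *)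
Lemma continuous_quadratic_modulus f M : continuous f -> forall e, 0 < e ->
  exists2 C : R, 0 <= C & forall x y, 0 <= x <= M -> 0 <= y <= M ->
    `|f x - f y| <= e + C * (x - y) ^+ 2.
Proof.
move=> fc e e0.
case: (leP 0 M) => [M0|M0]; last first.
  exists 0 => // x y /andP[x0 xM]; have := lt_le_trans (le_lt_trans xM M0) x0.
  by rewrite ltxx.
have cover : \forall d \near 0^'+, `[0, M] `<=`
    [set x | forall y, `|x - y| < d -> `|f x - f y| < e].
  move/compact_near_coveringP: (@segment_compact R 0 M) => cov.
  apply: (cov R (0^'+) (fun d x => forall y, `|x - y| < d -> `|f x - f y| < e)).
  move=> x _; have e2 : 0 < e / 2 by rewrite divr_gt0.
  have /cvgrPdist_lt/(_ _ e2)/nbhs_ballP[d /= d0 fd] := fc x.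
  exists (ball x (d / 2), [set t | t < d / 2]).
    split; first by apply: nbhsx_ballx; rewrite divr_gt0.
    by apply: nbhs_right_lt; rewrite divr_gt0.
  move=> [z t] [/= xz td] y zy.
  have fz : `|f x - f z| < e / 2.
    by apply: fd; apply: lt_trans xz _;
      rewrite ltr_pdivrMr // mulr_natr mulr2n ltrDl.
  have fy : `|f x - f y| < e / 2.
    apply: fd; rewrite /ball /= (splitr d) -(subrKA z).
    by rewrite (le_lt_trans (ler_normD _ _)) // ltrD // (lt_trans zy).
  rewrite (splitr e) -(subrKA (f x)) (le_lt_trans (ler_normD _ _)) // ltrD //.
  by rewrite distrC.
have /filter_ex[d [d0 fd]] : \forall d \near 0^'+, 0 < d /\ `[0, M] `<=`
    [set x | forall y, `|x - y| < d -> `|f x - f y| < e].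
  by apply: filterI cover; exact: nbhs_right_gt.
have [c _ Bf] : exists2 c : R, c \in `[0, M] &
    forall t : R, t \in `[0, M] -> `|f t| <= `|f c|.
  apply: EVT_max => //; apply: continuous_subspaceT => x.
  by apply: continuous_comp (fc x) _; exact: norm_continuous.
have C0 : 0 <= 2 * `|f c| / d ^+ 2 by rewrite divr_ge0 ?sqr_ge0 // mulr_ge0.
exists (2 * `|f c| / d ^+ 2) => //.
move=> x y xM yM; have [xy|xy] := ltP `|x - y| d.
  apply: le_trans (ltW (fd _ _ _ xy)) _; first by rewrite /= in_itv.
  by rewrite lerDl mulr_ge0 ?sqr_ge0.
apply: (@le_trans _ _ (2 * `|f c|)).
  by rewrite (le_trans (ler_normB _ _)) // mulr_natl mulr2n lerD ?Bf // in_itv.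
rewrite -[leLHS]add0r lerD ?(ltW e0) // [leRHS]mulrAC ler_pdivlMr ?exprn_gt0 //.
rewrite ler_wpM2l ?mulr_ge0 // -[leRHS]real_normK ?num_real //.
by rewrite ler_sqr ?nnegrE // ltW.
Qed.

(** By the quadratic modulus, the error of the Bernstein polynomial at [x] is at
    most [e / 2] plus a constant times the variance of [S_n / n], hence
    [O(1 / n)]. *)
Lemma weierstrass f M : continuous f -> forall e, 0 < e ->
  exists p : {poly R}, forall x, 0 <= x <= M -> `|p.[x] - f x| <= e.
Proof.
move=> fc e e0; have [M0|M0] := leP M 0.
  exists (f 0)%:P => x /andP[x0 xM].
  have -> : x = 0 by apply/eqP; rewrite eq_le x0 (le_trans xM).
  by rewrite hornerC subrr normr0 ltW.
have e20 : 0 < e / 2 by rewrite divr_gt0.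
have [C C0 fC] := @continuous_quadratic_modulus f M fc _ e20.
pose K := C * M ^+ 2; have K0 : 0 <= K by rewrite mulr_ge0 ?sqr_ge0.
pose n := (Num.truncn (K / (e / 2))).+1.
have n0 : 0 < n%:R :> R by rewrite ltr0n.
have Kn : K / n%:R <= e / 2.
  rewrite ler_pdivrMr // mulrC -ler_pdivrMr // ltW //.
  exact: truncnS_gt.
pose phi k := f (M * (k%:R / n%:R)).
exists (bernstein n phi \Po (M^-1 *: 'X)) => y /andP[y0 yM].
rewrite horner_comp hornerZ hornerX; set x := M^-1 * y.
have yE : y = M * x by rewrite mulVKf ?gt_eqF.
have x01 : 0 <= x <= 1.
  by rewrite mulr_ge0 ?invr_ge0 ?(ltW M0) //= /x mulrC ler_pdivrMr // mul1r.
pose psi k := (k%:R - n%:R * x) ^+ 2.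
have phi_psi k : (k <= n)%N ->
    `|phi k - f y| <= e / 2 + C * (M / n%:R) ^+ 2 * psi k.
  move=> kn; have := fC (M * (k%:R / n%:R)) y; rewrite -/(phi k).
  have -> : M * (k%:R / n%:R) - y = M / n%:R * (k%:R - n%:R * x).
    by rewrite yE; field; rewrite gt_eqF.
  rewrite exprMn [C * (_ * _)]mulrA; apply; last by rewrite y0.
  rewrite ger_pMr // ler_pdivrMr // mul1r ler_nat kn andbT.
  by rewrite mulr_ge0 ?(ltW M0) // divr_ge0 ?ler0n.
have momE : (bernstein n psi).[x] <= n%:R.
  rewrite bernstein_moment2 subrr expr0n /= addr0 -mulrA ger_pMr //.
  by case/andP: x01 => *; rewrite mulr_ile1 ?subr_ge0 // gerBl.
have bound : C * (M / n%:R) ^+ 2 * (bernstein n psi).[x] <= e / 2.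
  apply: le_trans Kn; apply: (@le_trans _ _ (C * (M / n%:R) ^+ 2 * n%:R)).
    by rewrite ler_wpM2l // mulr_ge0 ?sqr_ge0.
  rewrite le_eqVlt; apply/orP; left; apply/eqP.
  by rewrite /K; field; rewrite gt_eqF.
pose c := C * (M / n%:R) ^+ 2.
have up : (bernstein n phi).[x] <= f y + e / 2 + c * (bernstein n psi).[x].
  rewrite -[X in X + c * _]mul1r -(bernstein_cst n (f y + e / 2) x).
  rewrite -bernstein_lin; apply: bernstein_le => // k kn; rewrite mul1r.
  by have := phi_psi k kn; rewrite ler_norml -/c; lra.
have lo : f y - e / 2 - c * (bernstein n psi).[x] <= (bernstein n phi).[x].
  rewrite -(mulNr c) -[X in X + - c * _]mul1r -(bernstein_cst n (f y - e / 2) x).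
  rewrite -bernstein_lin; apply: bernstein_le => // k kn; rewrite mul1r.
  by have := phi_psi k kn; rewrite ler_norml -/c; lra.
by rewrite ler_norml; move: up lo bound; rewrite -/c; lra.
Qed.

(** The absolute value makes the power function continuous on the whole line;
    on the spectrum of a positive operator it changes nothing. *)
Lemma continuous_norm_powR s : 0 <= s -> continuous (fun x : R => `|x| `^ s).
Proof.
rewrite le_eqVlt => /predU1P[<-|s0] x.
  have -> : (fun x : R => `|x| `^ 0) = cst 1 by apply/funext => y; rewrite powRr0.
  exact: cvg_cst.
have [->|x0] := eqVneq x 0.
  apply/cvgrPdist_lt => e e0; rewrite normr0 powR0 ?gt_eqF //.
  exists (e `^ s^-1); first by rewrite /= powR_gt0.
  move=> y; rewrite /ball_ /= !sub0r !normrN => ye.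
  rewrite ger0_norm ?powR_ge0 // -[ltRHS]powRr1 ?ltW //.
  rewrite -(@mulVf _ s) ?gt_eqF // powRrM.
  by rewrite gt0_ltr_powR // ?nnegrE ?powR_ge0.
apply: (@continuous_comp _ _ _ (fun x : R => `|x|) (fun x => x `^ s)).
  exact: norm_continuous.
apply: differentiable_continuous; apply/derivable1_diffP.
by apply: derivable_powR; rewrite in_itv /= andbT normr_gt0.
Qed.

End Weierstrass.
(** * Real-valued norms and the real inner product *)

Section NormR.
Context {R : realType}.

Lemma normRE {V : normedZmodType R[i]} (x : V) : `|x| = (normR x)%:C.
Proof. by rewrite /normR RRe_real // ger0_real. Qed.

Lemma normR_ge0 {V : normedZmodType R[i]} (x : V) : 0 <= normR x.
Proof. by rewrite -ler0c -normRE. Qed.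

Lemma ler_normRD {V : normedZmodType R[i]} (x y : V) :
  normR (x + y) <= normR x + normR y.
Proof. by rewrite -lecR rmorphD /= -!normRE ler_normD. Qed.

Lemma normR0 {V : normedZmodType R[i]} : normR (0 : V) = 0.
Proof. by rewrite /normR normr0. Qed.

Lemma normR_eq0 {V : normedZmodType R[i]} (x : V) : (normR x == 0) = (x == 0).
Proof. by rewrite -(normr_eq0 x) normRE; apply/eqP/eqP => [->|[]]. Qed.

Lemma normRN {V : normedZmodType R[i]} (x : V) : normR (- x) = normR x.
Proof. by rewrite /normR normrN. Qed.

Lemma normRZ {H : normedModType R[i]} (a : R[i]) (x : H) :
  normR (a *: x) = normR a * normR x.
Proof. by apply: complexI; rewrite rmorphM /= -!normRE normrZ. Qed.

Lemma normR_real (r : R) : normR (r%:C : R[i]) = `|r|.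
Proof. by rewrite /normR normc_def /= expr0n addr0 sqrtr_sqr. Qed.

Lemma normRM (a b : R[i]) : normR (a * b) = normR a * normR b.
Proof. by apply: complexI; rewrite rmorphM /= -!normRE normrM. Qed.

Lemma normR_conj (a : R[i]) : normR (Num.conj a) = normR a.
Proof. by rewrite /normR norm_conjC. Qed.

Lemma ler_Re_normR (a : R[i]) : `|complex.Re a| <= normR a.
Proof. by rewrite -lecR -normRE normc_ge_Re. Qed.

End NormR.

Section InnerProduct.
Context {R : realType} {H : completeNormedModType R[i]}.
Variables (dot : {dot H for Num.conj}).
Hypothesis norm_dot : forall x : H, `|x| ^+ 2 = dot x x.
Implicit Types (x y z : H) (r s c e : R) (S T A : 'B(H)).

Definition ip x y : R := complex.Re (dot x y).

Lemma dotC x y : dot x y = Num.conj (dot y x).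
Proof. by rewrite hermC expr0 mul1r. Qed.

Lemma ipC x y : ip x y = ip y x.
Proof. by rewrite /ip dotC; case: (dot y x). Qed.

Lemma ipDl x y z : ip (x + y) z = ip x z + ip y z.
Proof. by rewrite /ip linearDl raddfD. Qed.

Lemma ipDr x y z : ip z (x + y) = ip z x + ip z y.
Proof. by rewrite ipC ipDl !(ipC z). Qed.

Lemma ipZl r x z : ip (r%:C *: x) z = r * ip x z.
Proof.
by rewrite /ip linearZl_LR /=; case: (dot x z) => a b /=; rewrite mul0r subr0.
Qed.

Lemma ipZr r x z : ip z (r%:C *: x) = r * ip z x.
Proof. by rewrite ipC ipZl ipC. Qed.

Lemma ipNl x z : ip (- x) z = - ip x z.
Proof.
by rewrite -[in LHS](scale1r x) -scaleNr -[1]/(1%:C) -rmorphN ipZl mulN1r.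
Qed.

Lemma ipNr x z : ip z (- x) = - ip z x.
Proof. by rewrite ipC ipNl ipC. Qed.

Lemma ipBl x y z : ip (x - y) z = ip x z - ip y z.
Proof. by rewrite ipDl ipNl. Qed.

Lemma ipBr x y z : ip z (x - y) = ip z x - ip z y.
Proof. by rewrite ipDr ipNr. Qed.

Lemma ip0l z : ip 0 z = 0.
Proof. by rewrite -(subrr 0) ipBl subrr. Qed.

Lemma ip0r z : ip z 0 = 0.
Proof. by rewrite ipC ip0l. Qed.

Lemma ipxx x : ip x x = normR x ^+ 2.
Proof.
apply: complexI; rewrite rmorphXn /= -normRE norm_dot /ip RRe_real //.
by rewrite -norm_dot realX // ger0_real.
Qed.

Lemma normR_sqrD x y :
  normR (x + y) ^+ 2 = normR x ^+ 2 + 2 * ip x y + normR y ^+ 2.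
Proof. by rewrite -!ipxx !ipDl !ipDr (ipC y x); ring. Qed.

Lemma normR_sqrB x y :
  normR (x - y) ^+ 2 = normR x ^+ 2 - 2 * ip x y + normR y ^+ 2.
Proof. by rewrite normR_sqrD ipNr normRN; ring. Qed.

Lemma ip_dot x y : dot x y = ip x y +i* ip x ('i *: y).
Proof.
rewrite /ip linearZr_LR /=; case: (dot x y) => a b /=.
by congr Complex; ring.
Qed.

Lemma ler_ip_dot x y : `|ip x y| <= normR (dot x y).
Proof. exact: ler_Re_normR. Qed.

(** Rotating [x] by a phase turns the modulus of the inner product into its real
    part, so inequalities for [ip] transfer to moduli. *)
Lemma dot_phase x y :
  exists2 u : R[i], normR u = 1 & normR (dot x y) = ip (u *: x) y.
Proof.
have [d0|d0] := eqVneq (dot x y) 0.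
  exists 1; last by rewrite scale1r /ip d0 normR0.
  by rewrite -[1]/(1%:C) normR_real normr1.
exists (Num.conj (dot x y) / `|dot x y|).
  rewrite normRM normR_conj; apply: complexI; rewrite rmorphM /= -!normRE.
  by rewrite normfV normr_id mulfV ?normr_eq0.
rewrite /ip linearZl_LR /= mulrAC [Num.conj _ * _]mulrC -normCK.
by rewrite expr2 mulfK ?normr_eq0.
Qed.

Lemma scaleiK x : 'i *: ('i *: x) = - x.
Proof. by rewrite scalerA -expr2 sqr_i scaleN1r. Qed.

Lemma ip_ii x y : ip ('i *: x) ('i *: y) = ip x y.
Proof.
rewrite /ip linearZl_LR linearZr_LR /=; case: (dot x y) => a b /=.
by ring.
Qed.

Lemma dot_of_ip (f g : H -> H) : (forall x, g ('i *: x) = 'i *: g x) ->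
  (forall x y, ip (f x) y = ip x (g y)) -> forall x y, dot (f x) y = dot x (g y).
Proof. by move=> gi fg x y; rewrite !ip_dot !fg gi. Qed.

(** Nonnegativity of the discriminant, the source of all the Cauchy-Schwarz
    inequalities below. *)
Lemma quadratic_ge0 (a b c : R) :
  (forall s, 0 <= a + 2 * s * b + s ^+ 2 * c) -> b ^+ 2 <= a * c.
Proof.
move=> q0; have a0 : 0 <= a by have := q0 0; rewrite expr0n /= mulr0 !mul0r !addr0.
have c0 : 0 <= c.
  rewrite leNgt; apply/negP => c0.
  (* For negative [c] the quadratic is negative at a large enough [s]. *)
  have := q0 ((2 * `|b| + a + 1) / - c + 1); set d := - c.
  have d0 : 0 < d by rewrite oppr_gt0.
  have -> : c = - d by rewrite opprK.
  set t := _ / d; have t0 : 0 <= t by rewrite divr_ge0 ?addr_ge0 ?mulr_ge0 // ltW.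
  have td : t * d = 2 * `|b| + a + 1 by rewrite /t mulfVK ?gt_eqF.
  have := ler_norm b; have := ler_norm (- b); rewrite normrN; nra.
have [c00|cn0] := eqVneq c 0.
  have [b0|bn0] := eqVneq b 0; first by rewrite b0 expr0n mulr_ge0.
  have := q0 (- (a + 1) / (2 * b)); rewrite c00 mulr0 addr0.
  have -> : a + 2 * (- (a + 1) / (2 * b)) * b = - 1 by field.
  by rewrite oppr_ge0 ler10.
have cp : 0 < c by rewrite lt_def cn0.
have := q0 (- b / c).
have -> : a + 2 * (- b / c) * b + (- b / c) ^+ 2 * c = (a * c - b ^+ 2) / c by field.
by rewrite pmulr_lge0 ?invr_gt0 // subr_ge0.
Qed.

Definition selfadj T := forall x y, ip (T x) y = ip x (T y).
Definition posop T := selfadj T /\ forall x, 0 <= ip (T x) x.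

Lemma opD T x y : T (x + y) = T x + T y.
Proof. by have := bop_linear T 1 x y; rewrite !scale1r. Qed.

Lemma op0 T : T 0 = 0.
Proof. by apply: (@addrI _ (T 0)); rewrite -opD !addr0. Qed.

Lemma opZ T (a : R[i]) x : T (a *: x) = a *: T x.
Proof. by have := bop_linear T a x 0; rewrite op0 !addr0. Qed.

Lemma opN T x : T (- x) = - T x.
Proof. by rewrite -[in LHS](scaleN1r x) opZ scaleN1r. Qed.

Lemma opB T x y : T (x - y) = T x - T y.
Proof. by rewrite opD opN. Qed.

Lemma mulopE S T x : (S * T) x = S (T x). Proof. by []. Qed.
Lemma addopE S T x : (S + T) x = S x + T x. Proof. by []. Qed.
Lemma oppopE S x : (- S) x = - S x. Proof. by []. Qed.
Lemma scaleopE (a : R[i]) S x : (a *: S) x = a *: S x. Proof. by []. Qed.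
Lemma oneopE x : (1 : 'B(H)) x = x. Proof. by []. Qed.
Lemma zeroopE x : (0 : 'B(H)) x = 0. Proof. by []. Qed.
Lemma sumopE (I : Type) (l : seq I) (F : I -> 'B(H)) x :
  (\sum_(i <- l) F i) x = \sum_(i <- l) F i x.
Proof. by elim/big_rec2: _ => //= i y S _ <-. Qed.

Definition opE := (mulopE, addopE, oppopE, scaleopE, oneopE, zeroopE).

Lemma scaleopAl (a : R[i]) S T : (a *: S) * T = a *: (S * T).
Proof. by apply: bopP. Qed.
Lemma scaleopAr (a : R[i]) S T : S * (a *: T) = a *: (S * T).
Proof. by apply: bopP => x; rewrite !opE opZ. Qed.

Lemma pos_cauchy_schwarz S : posop S ->
  forall x y, ip (S x) y ^+ 2 <= ip (S x) x * ip (S y) y.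
Proof.
move=> [Ss S0] x y; apply: quadratic_ge0 => s.
have := S0 (x + s%:C *: y); rewrite opD opZ !ipDl !ipDr !ipZl !ipZr.
by rewrite (Ss y x) (ipC y (S x)); congr (0 <= _); ring.
Qed.

Lemma pos1 : posop 1.
Proof. by split=> // x; rewrite opE ipxx sqr_ge0. Qed.

Lemma cauchy_schwarz x y : ip x y ^+ 2 <= normR x ^+ 2 * normR y ^+ 2.
Proof. by have := pos_cauchy_schwarz pos1 x y; rewrite !opE !ipxx. Qed.

Lemma ler_ip x y : `|ip x y| <= normR x * normR y.
Proof.
rewrite -ler_sqr ?nnegrE ?mulr_ge0 ?normR_ge0 //.
by rewrite real_normK ?num_real // exprMn cauchy_schwarz.
Qed.

Lemma ip_eq0 x : (forall z, ip x z = 0) -> x = 0.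
Proof. by move=> /(_ x) /eqP; rewrite ipxx sqrf_eq0 normR_eq0 => /eqP. Qed.

Lemma ip_inj x y : (forall z, ip x z = ip y z) -> x = y.
Proof.
move=> xy; apply/eqP; rewrite -subr_eq0; apply/eqP/ip_eq0 => z.
by rewrite ipBl xy subrr.
Qed.

Definition bounded_by T c := forall x, normR (T x) <= c * normR x.

Lemma exists_bounded_by T : exists2 c, 0 <= c & bounded_by T c.
Proof.
have [M TM] := bop_bounded T; exists (normR M); first exact: normR_ge0.
move=> x; have [->|x0] := eqVneq x 0; first by rewrite op0 !normR0 mulr0.
rewrite -lecR rmorphM /= -!normRE; apply: le_trans (TM x) _.
rewrite ler_wpM2r //; apply: real_ler_norm.
have xp : 0 < `|x| by rewrite normr_gt0.
have : 0 <= M by rewrite -(pmulr_lge0 M xp) (le_trans _ (TM x)).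
exact: ger0_real.
Qed.

Lemma seq_complete (u : nat -> H) :
  (forall e, 0 < e -> exists N, forall n m, (N <= n)%N -> (N <= m)%N ->
     normR (u n - u m) <= e) ->
  exists l, forall e, 0 < e -> exists N, forall n, (N <= n)%N -> normR (u n - l) <= e.
Proof.
move=> cu; suff /cauchy_cvg/cvg_ex[l /cvgrPdist_le ul] : cauchy (u @ \oo).
  exists l => e e0; have e0' : 0 < e%:C by rewrite ltcR.
  have [N _ Nu] := ul _ e0'.
  exists N => n /Nu /=; rewrite normRE lecR -normRN opprB.
  by [].
apply/cauchy_ballP => e e0.
have er : e = (complex.Re e)%:C by rewrite RRe_real // gtr0_real.
rewrite er; have e0' : 0 < complex.Re e / 2 by rewrite divr_gt0 // -ltcR -er.
have [N Nu] := cu _ e0'.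
pose tail := [set u n | n in [set n | (N <= n)%N]].
have tail_near : \forall x \near u @ \oo, tail x.
  by exists N => // n nN; exists n.
exists (tail, tail) => // -[x y] [/= [n nN <-] [m mN <-]].
rewrite -ball_normE /ball_ /= normRE ltcR.
apply: le_lt_trans (Nu _ _ nN mN) _.
by rewrite ltr_pdivrMr // ltr_pMr ?ltr1n // -ltcR -er.
Qed.

Lemma inv_succ_small c e : 0 <= c -> 0 < e ->
  exists N, forall n, (N <= n)%N -> c / n.+1%:R <= e.
Proof.
move=> c0 e0; exists (Num.truncn (c / e)) => n Nn.
rewrite ler_pdivrMr ?ltr0n // mulrC -ler_pdivrMr // ltW //.
apply: lt_le_trans (truncnS_gt _) _.
by rewrite ler_nat ltnS.
Qed.

(** The energy [J x = <S x, x> - 2 phi x] is bounded below, and by the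
    parallelogram identity for the form of [S] its minimising sequences are Cauchy;
    the limit satisfies the Euler-Lagrange equation.  With [S = 1] this is the Riesz
    representation theorem.  Only real-linear functionals are considered, so
    that it applies to [ip]. *)
Lemma lax_milgram S c (phi : H -> R) K : posop S -> 0 < c ->
    (forall x, c * normR x ^+ 2 <= ip (S x) x) ->
    (forall x y, phi (x + y) = phi x + phi y) ->
    (forall r x, phi (r%:C *: x) = r * phi x) ->
    (forall x, `|phi x| <= K * normR x) ->
  exists x, forall z, phi z = ip (S x) z.
Proof.
move=> Sp c0 Sc phiD phiZ phiK; have [Ss S0] := Sp.
pose J x := ip (S x) x - 2 * phi x.
have JE x z s : J (x + s%:C *: z) =
    J x + 2 * s * (ip (S x) z - phi z) + s ^+ 2 * ip (S z) z.
  rewrite /J opD opZ !ipDl !ipDr !ipZl !ipZr phiD phiZ (Ss z x) (ipC z (S x)).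
  by ring.
have Jlow x : - (K ^+ 2 / c) <= J x.
  have := Sc x; have := phiK x; rewrite ler_norml => /andP[_ phix] Scx.
  apply: (@le_trans _ _ (c * normR x ^+ 2 - 2 * (K * normR x))); last first.
    by rewrite /J; lra.
  rewrite -subr_ge0.
  have -> : c * normR x ^+ 2 - 2 * (K * normR x) - - (K ^+ 2 / c) =
     (c * normR x - K) ^+ 2 / c by field; rewrite gt_eqF.
  by rewrite divr_ge0 ?sqr_ge0 // ltW.
pose m := inf (range J).
have Jinf : has_inf (range J).
  split; first by exists (J 0); exists 0.
  by exists (- (K ^+ 2 / c)) => _ [x _ <-].
have Jm x : m <= J x by apply: ge_inf; [case: Jinf|exists x].
have [u uJ] : {u : nat -> H & forall n, J (u n) < m + n.+1%:R^-1}.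
  apply: (@choice _ _ (fun n x => J x < m + n.+1%:R^-1)) => n.
  have n0 : 0 < n.+1%:R^-1 :> R by rewrite invr_gt0.
  by have [_ [x _ <-] Jx] := inf_adherent n0 Jinf; exists x.
(* Near-minimisers are close to each other: the energy at their midpoint is at
   least [m]. *)
have near_min x y (d : R) : J x <= m + d -> J y <= m + d ->
    c * normR (y - x) ^+ 2 <= 4 * d.
  move=> Jx Jy; apply: le_trans (Sc _) _; set h := y - x.
  have := JE x h 1; rewrite scale1r /h subrKC -/h => Jy'.
  have := Jm (x + (2^-1)%:C *: h); rewrite JE.
  by move: Jx Jy; rewrite Jy'; lra.
have [x ux] : exists x, forall e, 0 < e ->
    exists N, forall n, (N <= n)%N -> normR (u n - x) <= e.
  apply: seq_complete => e e0.
  have ce : 0 < c * e ^+ 2 by rewrite mulr_gt0 ?exprn_gt0.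
  have [N HN] := @inv_succ_small 4 _ (ler0n _ _) ce.
  exists N => n k nN kN.
  have tailJ j : (N <= j)%N -> J (u j) <= m + N.+1%:R^-1.
    move=> Nj; apply: le_trans (ltW (uJ j)) _; rewrite lerD2l.
    by rewrite lef_pV2 ?posrE ?ltr0n // ler_nat ltnS.
  have := near_min _ _ _ (tailJ _ kN) (tailJ _ nN).
  move=> /le_trans/(_ (HN _ (leqnn _))); rewrite ler_pM2l //.
  by rewrite ler_sqr ?nnegrE ?normR_ge0 // ltW.
exists x => z; apply/eqP; rewrite eq_sym -subr_eq0 -normr_le0.
apply/ler_addgt0Pr => e e0; rewrite add0r.
have e20 : 0 < e / 2 by rewrite divr_gt0.
have z1 : 0 < normR (S z) + 1 by rewrite ltr_wpDl ?normR_ge0.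
have [N1 HN1] := ux (e / 2 / (normR (S z) + 1)) (divr_gt0 e20 z1).
have [N2 HN2] :=
  @inv_succ_small (ip (S z) z) ((e / 2) ^+ 2) (S0 z) (exprn_gt0 _ e20).
pose n := maxn N1 N2.
(* Near-minimality makes the first variation at [u n] small. *)
have an : `|ip (S (u n)) z - phi z| <= e / 2.
  rewrite -ler_sqr ?nnegrE ?normr_ge0 ?(ltW e20) // real_normK ?num_real //.
  apply: le_trans (HN2 n (leq_maxr _ _)).
  apply: (@le_trans _ _ ((J (u n) - m) * ip (S z) z)).
    apply: quadratic_ge0 => s; have := Jm (u n + s%:C *: z); rewrite JE; lra.
  by rewrite mulrC ler_wpM2l // lerBlDl ltW.
have xn : `|ip (S (x - u n)) z| <= e / 2.
  rewrite Ss; apply: le_trans (ler_ip _ _) _.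
  rewrite -[x - _]opprB normRN.
  apply: (@le_trans _ _ (e / 2 / (normR (S z) + 1) * (normR (S z) + 1))).
    rewrite ler_pM ?normR_ge0 ?lerDl //.
    exact: HN1 (leq_maxl _ _).
  by rewrite divfK ?gt_eqF.
rewrite (splitr e); apply: le_trans (lerD xn an).
apply: le_trans (ler_normD _ _).
by rewrite opB ipBl addrA subrK.
Qed.

Lemma complex_split (a : R[i]) x :
  a *: x = (complex.Re a)%:C *: x + (complex.Im a)%:C *: ('i *: x).
Proof. by rewrite scalerA -scalerDl mulrC; congr (_ *: _); exact: complexE. Qed.

(** A real-linear map that commutes with multiplication by [i] is complex-linear. *)
Lemma real_linear_bop (g : H -> H) c :
    (forall x y, g (x + y) = g x + g y) ->
    (forall r x, g (r%:C *: x) = r%:C *: g x) ->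
    (forall x, g ('i *: x) = 'i *: g x) ->
    (forall x, normR (g x) <= c * normR x) ->
  exists S : 'B(H), forall x, S x = g x.
Proof.
move=> gD gr gi gb.
have gin : g \in bounded_op_pred.
  apply/bounded_opP; split.
    by move=> a x y; rewrite gD complex_split gD !gr gi -complex_split.
  by exists c%:C => x; rewrite !normRE -rmorphM /= lecR.
by exists (BoundedOp gin).
Qed.

Lemma ip_il x y : ip ('i *: x) y = - ip x ('i *: y).
Proof. by rewrite -(ip_ii x) scaleiK ipNr opprK. Qed.

Lemma adjoint_exists T : exists S, forall x y, ip (T x) y = ip x (S y).
Proof.
have [c c0 Tc] := exists_bounded_by T.
have [g gP] : {g : H -> H & forall y z, ip (T z) y = ip (g y) z}.
  apply: (@choice _ _ (fun y w => forall z, ip (T z) y = ip w z)) => y.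
  have [||||||x xP] := @lax_milgram 1 1 (fun z => ip (T z) y) (c * normR y);
    last by exists x.
  - exact: pos1.
  - exact: ltr01.
  - by move=> x; rewrite opE ipxx mul1r.
  - by move=> x z; rewrite opD ipDl.
  - by move=> r x; rewrite opZ ipZl.
  - move=> x; apply: le_trans (ler_ip _ _) _.
    by rewrite mulrAC ler_wpM2r ?normR_ge0.
have gb x : normR (g x) <= c * normR x.
  have [->|gx0] := eqVneq (normR (g x)) 0; first by rewrite mulr_ge0 ?normR_ge0.
  have gx : 0 < normR (g x) by rewrite lt_def gx0 normR_ge0.
  rewrite -(ler_pM2r gx) -expr2 -ipxx -gP.
  apply: le_trans (ler_norm _) _; apply: le_trans (ler_ip _ _) _.
  by rewrite mulrAC ler_wpM2r ?normR_ge0.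
have [||||S SE] := @real_linear_bop g c.
- by move=> x y; apply: ip_inj => z; rewrite -gP ipDr ipDl !gP.
- by move=> r x; apply: ip_inj => z; rewrite -gP ipZr ipZl gP.
- by move=> x; apply: ip_inj => z; rewrite -gP ip_il -gP opZ ip_il opprK.
- exact: gb.
by exists S => x y; rewrite SE gP ipC.
Qed.

Lemma op_adjP T x y : ip (T x) y = ip x (op_adj dot T y).
Proof.
have [S TS] := adjoint_exists T.
have adjS : [set S : 'B(H) | forall x y, dot (T x) y = dot x (S y)] S.
  by apply: dot_of_ip => // z; rewrite opZ.
by have := xgetPex 0 (ex_intro _ S adjS) x y; rewrite /ip => ->.
Qed.

Lemma op_adj_uniq T S : (forall x y, ip (T x) y = ip x (S y)) -> op_adj dot T = S.
Proof.
move=> TS; apply: bopP => y; apply: ip_inj => z.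
by rewrite ipC -op_adjP TS ipC.
Qed.

Lemma op_adjK T : op_adj dot (op_adj dot T) = T.
Proof. by apply: op_adj_uniq => x y; rewrite ipC -op_adjP ipC. Qed.

(** Surjectivity is Lax-Milgram for the functional [<y, .>]. *)
Lemma coercive_inv S c : posop S -> 0 < c ->
    (forall x, c * normR x ^+ 2 <= ip (S x) x) ->
  exists S', S * S' = 1 /\ S' * S = 1.
Proof.
move=> Sp c0 Sc.
have [g gP] : {g : H -> H & forall y, S (g y) = y}.
  apply: (@choice _ _ (fun y w => S w = y)) => y.
  have [|||x xP] := @lax_milgram S c (ip y) (normR y) Sp c0 Sc; last first.
    by exists x; apply: ip_inj => z; rewrite -xP.
  - by move=> x; exact: ler_ip.
  - by move=> r x; rewrite ipZr.
  - by move=> x z; rewrite ipDr.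
have Sb x : normR x <= c^-1 * normR (S x).
  have [->|x0] := eqVneq (normR x) 0.
    by rewrite mulr_ge0 ?normR_ge0 // invr_ge0 ltW.
  have xp : 0 < normR x by rewrite lt_def x0 normR_ge0.
  rewrite mulrC ler_pdivlMr // -(ler_pM2r xp) mulrAC -expr2 mulrC.
  apply: le_trans (Sc x) _; apply: le_trans (ler_norm _) _; exact: ler_ip.
have Sinj x y : S x = S y -> x = y.
  move=> Sxy; apply/eqP; rewrite -subr_eq0 -normR_eq0 eq_le normR_ge0 andbT.
  by apply: le_trans (Sb _) _; rewrite opB Sxy subrr normR0 mulr0.
have [||||S' SE] := @real_linear_bop g c^-1.
- by move=> x y; apply: Sinj; rewrite opD !gP.
- by move=> r x; apply: Sinj; rewrite opZ !gP.
- by move=> x; apply: Sinj; rewrite opZ !gP.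
- by move=> x; apply: le_trans (Sb _) _; rewrite gP.
exists S'; split; apply: bopP => x; rewrite !opE SE ?gP //.
by apply: Sinj; rewrite gP.
Qed.

Lemma selfadjD S T : selfadj S -> selfadj T -> selfadj (S + T).
Proof. by move=> Ss Ts x y; rewrite !opE ipDl ipDr Ss Ts. Qed.

Lemma selfadjZ r S : selfadj S -> selfadj (r%:C *: S).
Proof. by move=> Ss x y; rewrite !opE ipZl ipZr Ss. Qed.

Lemma bounded_by_ip T M x : bounded_by T M -> `|ip (T x) x| <= M * normR x ^+ 2.
Proof.
move=> TM; apply: le_trans (ler_ip _ _) _.
by rewrite expr2 mulrA ler_wpM2r ?normR_ge0.
Qed.

(** Outside [[0, M]] one of [T - r], [r - T] is coercive, hence invertible. *)
Lemma pos_spectrum T M r : posop T -> bounded_by T M -> spectrum T r%:C ->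
  0 <= r <= M.
Proof.
move=> [Ts T0] TM sr; apply/andP; split; rewrite leNgt; apply/negP => r0; apply: sr.
  have coer x : - r * normR x ^+ 2 <= ip ((T - r%:C *: (1 : 'B(H))) x) x.
    by rewrite !opE ipBl ipZl ipxx mulNr lerBrDr addNr.
  have r0' : 0 < - r by rewrite oppr_gt0.
  apply: (@coercive_inv _ (- r)) => //.
  split; last first.
    by move=> x; apply: le_trans (coer x); rewrite mulr_ge0 ?sqr_ge0 // ltW.
  rewrite -scaleNr -rmorphN; apply: selfadjD => //; exact: selfadjZ.
pose S : 'B(H) := r%:C *: (1 : 'B(H)) - T.
have coer x : (r - M) * normR x ^+ 2 <= ip (S x) x.
  rewrite !opE ipBl ipZl ipxx mulrBl lerD2l lerN2.
  by apply: le_trans (ler_norm _) _; exact: bounded_by_ip.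
have rM : 0 < r - M by rewrite subr_gt0.
have [|S' [SS' S'S]] := @coercive_inv S (r - M) _ rM coer.
  split; last first.
    by move=> x; apply: le_trans (coer x); rewrite mulr_ge0 ?sqr_ge0 // ltW.
  rewrite /S addrC -scaleN1r -[-1]/(- 1%:C) -rmorphN; apply: selfadjD;
    exact: selfadjZ.
by exists (- S'); rewrite -opprB -/S !mulrNN.
Qed.

(** * Suprema over the unit sphere *)

(** Nonnegativity of [c] accounts for the zero space, where the supremum of the
    empty set is 0. *)
Lemma unit_sup_le (g : H -> R) c : 0 <= c -> (forall x, normR x = 1 -> g x <= c) ->
  sup [set g x | x in [set x | `|x| = 1]] <= c.
Proof.
move=> c0 gc; set A := [set _ | _ in _].
have [->|/set0P A0] := eqVneq A set0; first by rewrite sup0.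
by apply: ge_sup => // _ [x /= x1 <-]; apply: gc; rewrite /normR x1.
Qed.

Lemma unit_sup_ub (g : H -> R) c x : (forall x, normR x = 1 -> g x <= c) ->
  normR x = 1 ->
  g x <= sup [set g x | x in [set x | `|x| = 1]].
Proof.
move=> gc x1; apply: ub_le_sup.
  by exists c => _ [y /= y1 <-]; apply: gc; rewrite /normR y1.
by exists x => //=; rewrite normRE x1.
Qed.

Lemma unit_sup_ge0 (g : H -> R) c :
  (forall x, normR x = 1 -> g x <= c) -> (forall x, 0 <= g x) ->
  0 <= sup [set g x | x in [set x | `|x| = 1]].
Proof.
move=> gc g0; have [[x x1]|nx] := pselect (exists x : H, normR x = 1).
  exact: le_trans (g0 x) (unit_sup_ub gc x1).
rewrite (_ : image _ _ = set0) ?sup0 //; apply/seteqP; split=> // _ [x /= x1 _].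
by apply: nx; exists x; rewrite /normR x1.
Qed.

Lemma unit_decomp x : x != 0 -> exists2 y, normR y = 1 & x = (normR x)%:C *: y.
Proof.
rewrite -normR_eq0 => x0; exists ((normR x)^-1%:C *: x).
  by rewrite normRZ normR_real ger0_norm ?invr_ge0 ?normR_ge0 // mulVf.
by rewrite scalerA -rmorphM /= mulfV // scale1r.
Qed.

Lemma bounded_by_unit T c : bounded_by T c -> forall x, normR x = 1 ->
  normR (T x) <= c.
Proof. by move=> Tc x x1; rewrite -[c]mulr1 -x1. Qed.

Lemma op_norm_ge0 T : 0 <= op_norm T.
Proof.
have [c _ Tc] := exists_bounded_by T;
  apply: unit_sup_ge0 (bounded_by_unit Tc) _ => x.
exact: normR_ge0.
Qed.

Lemma bounded_by_op_norm T : bounded_by T (op_norm T).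
Proof.
move=> x; have [->|x0] := eqVneq x 0; first by rewrite op0 !normR0 mulr0.
have [y y1 ->] := unit_decomp x0; have [c _ Tc] := exists_bounded_by T.
rewrite opZ !normRZ normR_real y1 mulr1 [leRHS]mulrC ler_wpM2l //.
exact: unit_sup_ub (bounded_by_unit Tc) y1.
Qed.

Lemma op_norm_le T c : 0 <= c -> bounded_by T c -> op_norm T <= c.
Proof. by move=> c0 Tc; apply: unit_sup_le => // x; exact: bounded_by_unit. Qed.

(** * Polynomials of an operator and the spectral norm bound *)

Local Notation Id := (1 : 'B(H)).

(** Complex coefficients are needed to factor a polynomial into linear factors. *)
Definition op_cpoly (p : {poly R[i]}) T : 'B(H) := \sum_(i < size p) p`_i *: T ^+ i.

Lemma op_cpoly_wide n (p : {poly R[i]}) T : (size p <= n)%N ->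
  op_cpoly p T = \sum_(i < n) p`_i *: T ^+ i.
Proof.
move=> pn; rewrite /op_cpoly (big_ord_widen n (fun i => p`_i *: T ^+ i) pn).
rewrite big_mkcond /=; apply: eq_bigr => i _; case: ltnP => // ip.
by rewrite nth_default // scale0r.
Qed.

Lemma op_cpolyD (p q : {poly R[i]}) T :
  op_cpoly (p + q) T = op_cpoly p T + op_cpoly q T.
Proof.
pose n := maxn (size p) (size q).
rewrite (@op_cpoly_wide n) ?size_polyD // (@op_cpoly_wide n p) ?leq_maxl //.
rewrite (@op_cpoly_wide n q) ?leq_maxr // -big_split /=.
by apply: eq_bigr => i _; rewrite coefD scalerDl.
Qed.

Lemma op_cpolyZ (a : R[i]) (p : {poly R[i]}) T :
  op_cpoly (a *: p) T = a *: op_cpoly p T.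
Proof.
rewrite (@op_cpoly_wide (size p)) ?size_scale_leq // /op_cpoly scaler_sumr.
by apply: eq_bigr => i _; rewrite coefZ scalerA.
Qed.

Lemma op_cpolyC (a : R[i]) T : op_cpoly a%:P T = a *: Id.
Proof.
by rewrite (@op_cpoly_wide 1) ?size_polyC_leq1 // big_ord1 coefC /= expr0.
Qed.

Lemma op_cpolyMX (p : {poly R[i]}) T : op_cpoly (p * 'X) T = op_cpoly p T * T.
Proof.
have [->|p0] := eqVneq p 0.
  by rewrite mul0r -[0]/(0%:P) op_cpolyC scale0r mul0r.
rewrite /op_cpoly size_mulX // big_ord_recl coefMX eqxx scale0r add0r.
rewrite mulr_suml; apply: eq_bigr => i _.
by rewrite coefMX /= exprSr scaleopAl.
Qed.

Lemma op_cpolyM (p q : {poly R[i]}) T :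
  op_cpoly (p * q) T = op_cpoly p T * op_cpoly q T.
Proof.
have op_cpolyMC (c : R[i]) (r : {poly R[i]}) :
  op_cpoly (r * c%:P) T = op_cpoly r T * op_cpoly c%:P T.
  by rewrite mulrC mul_polyC op_cpolyZ op_cpolyC scaleopAr mulr1.
elim/poly_ind: q => [|q c IH];
  first by rewrite mulr0 -[0]/(0%:P) op_cpolyC scale0r mulr0.
by rewrite mulrDr !op_cpolyD mulrA !op_cpolyMX IH op_cpolyMC mulrDr mulrA.
Qed.

Lemma op_cpolyX T : op_cpoly 'X T = T.
Proof. by rewrite -['X]mul1r op_cpolyMX -[1]/(1%:P) op_cpolyC scale1r mul1r. Qed.

Lemma op_polyE (p : {poly R}) T :
  op_poly p T = op_cpoly (map_poly (real_complex R) p) T.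
Proof.
by rewrite /op_cpoly size_map_poly; apply: eq_bigr => i _; rewrite coef_map.
Qed.

Lemma op_polyD (p q : {poly R}) T : op_poly (p + q) T = op_poly p T + op_poly q T.
Proof. by rewrite !op_polyE rmorphD op_cpolyD. Qed.

Lemma op_polyM (p q : {poly R}) T : op_poly (p * q) T = op_poly p T * op_poly q T.
Proof. by rewrite !op_polyE rmorphM op_cpolyM. Qed.

Lemma op_polyC r T : op_poly r%:P T = r%:C *: Id.
Proof. by rewrite op_polyE map_polyC op_cpolyC. Qed.

Lemma op_polyX T : op_poly 'X T = T.
Proof. by rewrite op_polyE map_polyX op_cpolyX. Qed.

Lemma op_polyZ r (p : {poly R}) T : op_poly (r *: p) T = r%:C *: op_poly p T.
Proof. by rewrite -mul_polyC op_polyM op_polyC scaleopAl mul1r. Qed.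

Lemma op_polyB (p q : {poly R}) T : op_poly (p - q) T = op_poly p T - op_poly q T.
Proof.
by rewrite -[X in op_poly (_ + X)]scaleN1r op_polyD op_polyZ rmorphN scaleN1r.
Qed.

Lemma selfadj_poly (p : {poly R}) T : selfadj T -> selfadj (op_poly p T).
Proof.
move=> Ts; elim/poly_ind: p => [|p c IH].
  by rewrite -[0]/(0%:P) op_polyC; exact: selfadjZ.
rewrite op_polyD op_polyC; apply: selfadjD; last exact: selfadjZ.
have E1 : op_poly (p * 'X) T = op_poly p T * T by rewrite op_polyM op_polyX.
have E2 : op_poly (p * 'X) T = T * op_poly p T by rewrite mulrC op_polyM op_polyX.
by move=> x y; rewrite {1}E1 E2 !mulopE IH Ts.
Qed.

(** The failure of this property, unlike that of invertibility, passes from a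
    product to one of its factors by an elementary argument. *)
Definition bounded_below S :=
  exists2 c, 0 < c & forall x, c * normR x <= normR (S x).

Lemma bounded_belowM S T : bounded_below S -> bounded_below T ->
  bounded_below (S * T).
Proof.
move=> [c c0 Sc] [d d0 Td]; exists (c * d); first exact: mulr_gt0.
by move=> x; rewrite -mulrA mulopE (le_trans _ (Sc _)) // ler_wpM2l // ltW.
Qed.

Lemma bounded_belowZ (a : R[i]) : a != 0 -> bounded_below (a *: Id).
Proof.
move=> a0; exists (normR a) => [|x]; rewrite ?opE ?normRZ //.
by rewrite lt_def normR_eq0 a0 normR_ge0.
Qed.

Lemma bounded_below_inv S S' : S' * S = 1 -> bounded_below S.
Proof.
move=> S'S; have [c c0 Sc] := exists_bounded_by S'.
have c1 : 0 < c + 1 by rewrite ltr_wpDl.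
exists (c + 1)^-1; first by rewrite invr_gt0.
move=> x; rewrite mulrC ler_pdivrMr //.
rewrite -[x in normR x]oneopE -S'S mulopE (le_trans (Sc _)) // mulrC.
by rewrite ler_wpM2l ?normR_ge0 // lerDl.
Qed.

Lemma ip_selfadj_i S x : selfadj S -> ip (S x) ('i *: x) = 0.
Proof.
move=> Ss; have : ip (S x) ('i *: x) = - ip (S x) ('i *: x).
  by rewrite {1}Ss opZ ipC ip_il.
by lra.
Qed.

(** With [a = s + i b], [|(T - a) x|^2 = |(T - s) x|^2 + b^2 |x|^2], because
    [<(T - s) x, x>] is real. *)
Lemma bounded_below_nonreal T (a : R[i]) : selfadj T -> complex.Im a != 0 ->
  bounded_below (T - a *: Id).
Proof.
move=> Ts b0; exists `|complex.Im a|; first by rewrite normr_gt0.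
move=> x; set b := complex.Im a; pose U : 'B(H) := T - (complex.Re a)%:C *: Id.
have Us : selfadj U.
  by rewrite /U -scaleNr -rmorphN; apply: selfadjD => //; exact: selfadjZ.
rewrite -ler_sqr ?nnegrE ?mulr_ge0 ?normR_ge0 //.
have -> : (T - a *: Id : 'B(H)) x = U x - b%:C *: ('i *: x).
  by rewrite !opE complex_split opprD addrA.
rewrite normR_sqrB ipZr ip_selfadj_i // !mulr0 subr0 normRZ normR_real.
rewrite -[normR (_ *: x)]/(normR ('i *: x)).
have -> : normR ('i *: x) = normR x.
  by apply/eqP; rewrite -(@eqrXn2 _ 2) ?normR_ge0 // -!ipxx ip_ii.
by rewrite lerDr sqr_ge0.
Qed.

Lemma not_bounded_below_factor (rs : seq R[i]) T :
  ~ bounded_below (op_cpoly (\prod_(r <- rs) ('X - r%:P)) T) ->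
  exists2 r, r \in rs & ~ bounded_below (T - r *: Id).
Proof.
elim: rs => [|r rs IH].
  rewrite big_nil -[1]/(1%:P) op_cpolyC; case; apply: bounded_belowZ;
    exact: oner_neq0.
rewrite big_cons op_cpolyM => nb.
have [b1|nb1] := pselect (bounded_below (T - r *: Id)); last first.
  by exists r; rewrite ?mem_head.
have [s srs nbs] : exists2 s, s \in rs & ~ bounded_below (T - s *: Id).
  apply: IH => b2; apply: nb; apply: bounded_belowM => //.
  by rewrite op_cpolyD -polyCN op_cpolyC op_cpolyX scaleNr.
by exists s => //; rewrite in_cons srs orbT.
Qed.

(** Factor [q] over the complex numbers: one of the operators [T - r], [r] a root,
    is not bounded below.  Such an [r] is real and lies in the spectrum. *)
Lemma not_bounded_below_root (q : {poly R}) T : selfadj T -> q != 0 ->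
  ~ bounded_below (op_poly q T) ->
  exists2 r, spectrum T r%:C & root q r.
Proof.
move=> Ts q0; rewrite op_polyE; set qc := map_poly _ q.
have qc0 : qc != 0 by rewrite map_poly_eq0.
have [rs qE] := closed_field_poly_normal qc.
rewrite qE op_cpolyZ => nb.
have [r rrs nbr] : exists2 r, r \in rs & ~ bounded_below (T - r *: Id).
  apply: not_bounded_below_factor => b; apply: nb;
    rewrite -[op_cpoly _ _]mul1r -scaleopAl.
  apply: bounded_belowM => //; apply: bounded_belowZ; by rewrite lead_coef_eq0.
have rE : r = (complex.Re r)%:C.
  apply/eqP; rewrite eq_complex /= eqxx /=; apply/negP => /negP im0.
  exact: nbr (bounded_below_nonreal Ts im0).
exists (complex.Re r).
  by rewrite -rE => -[S [_ SE]]; apply: nbr; exact: bounded_below_inv SE.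
have : root qc r.
  rewrite qE rootZ ?lead_coef_eq0 // root_prod_XsubC //.
by rewrite rE /root horner_map fmorph_eq0.
Qed.

(** On unit vectors that nearly attain the norm [N] of [S], the operator
    [S^2 - N^2] is small, because
    [|(S^2 - N^2) x|^2 <= N^2 (N^2 - |S x|^2)]. *)
Lemma not_bounded_below_norm S : selfadj S -> (exists x : H, normR x = 1) ->
  ~ bounded_below (S * S - (op_norm S ^+ 2)%:C *: Id).
Proof.
move=> Ss [x1 x11] [c c0 Sc]; set N := op_norm S in Sc.
have N0 : 0 <= N := op_norm_ge0 S.
have key x : normR x = 1 -> c ^+ 2 <= N ^+ 2 * (N ^+ 2 - normR (S x) ^+ 2).
  move=> nx; have := Sc x;
    rewrite nx mulr1 -ler_sqr ?nnegrE ?normR_ge0 ?(ltW c0) //.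
  move=> /le_trans; apply;
    rewrite !opE normR_sqrB ipZr Ss ipxx normRZ normR_real nx.
  have : normR (S (S x)) ^+ 2 <= N ^+ 2 * normR (S x) ^+ 2.
    by rewrite -exprMn ler_sqr ?nnegrE ?mulr_ge0 ?normR_ge0 //;
      exact: bounded_by_op_norm.
  rewrite mulr1 real_normK ?num_real //; nra.
have cN : c ^+ 2 <= N ^+ 4.
  apply: le_trans (key _ x11) _;
    rewrite -[4%N]/(2 + 2)%N exprD ler_wpM2l ?sqr_ge0 //.
  by rewrite gerBl sqr_ge0.
have Np : 0 < N.
  rewrite lt_def N0 andbT; apply/eqP => N00; move: cN; rewrite N00 expr0n /=.
  by rewrite leNgt exprn_gt0.
have N2 : 0 < N ^+ 2 by rewrite exprn_gt0.
(* Were [S^2 - N^2] bounded below by [c], the square of the norm of [S] would not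
   exceed [t], which is less than [N^2]. *)
pose t := N ^+ 2 - c ^+ 2 / N ^+ 2.
have tlt : t < N ^+ 2 by rewrite gtrBl divr_gt0 ?exprn_gt0.
have Sxt x : normR x = 1 -> normR (S x) ^+ 2 <= t.
  by move=> /key; rewrite mulrC -ler_pdivrMr // /t; lra.
have t0 : 0 <= t by apply: le_trans (Sxt _ x11); rewrite sqr_ge0.
have : N <= Num.sqrt t.
  apply: unit_sup_le; first exact: sqrtr_ge0.
  by move=> x /Sxt Sx; rewrite -(ger0_norm (normR_ge0 (S x))) -sqrtr_sqr ler_sqrt.
rewrite -ler_sqr ?nnegrE ?sqrtr_ge0 // sqr_sqrtr //.
by rewrite leNgt tlt.
Qed.

(** The norm of [p(T)] is attained by [|p|] on the spectrum.  The hypothesis on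
    [p^2 - N^2] excludes constant polynomials of modulus [N], for which the
    root-finding argument says nothing. *)
Lemma spectrum_poly_norm (p : {poly R}) T : selfadj T ->
  (exists x : H, normR x = 1) ->
  p ^+ 2 - (op_norm (op_poly p T) ^+ 2)%:P != 0 ->
  exists2 r, spectrum T r%:C & `|p.[r]| = op_norm (op_poly p T).
Proof.
move=> Ts nt q0; have := not_bounded_below_norm (selfadj_poly p Ts) nt.
rewrite -op_polyM -expr2 -(op_polyC _ T) -op_polyB =>
  /(not_bounded_below_root Ts q0)[r sr].
rewrite /root !hornerE subr_eq0 => /eqP pr; exists r => //.
by apply/eqP; rewrite -(@eqrXn2 _ 2) ?op_norm_ge0 // real_normK ?num_real // pr.
Qed.

(** Apply the previous lemma to the nonconstant polynomial [X]. *)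
Lemma spectrum_neq0 T : selfadj T -> (exists x : H, normR x = 1) ->
  exists r, spectrum T r%:C.
Proof.
move=> Ts nt; have [|r sr _] := @spectrum_poly_norm 'X T Ts nt; last by exists r.
apply/eqP => /(congr1 (fun q : {poly R} => q`_2)) /eqP.
by rewrite coefB coefXn coefC coef0 subr0 oner_eq0.
Qed.

Lemma op_poly_bound (p : {poly R}) T c : selfadj T -> 0 <= c ->
  (forall r, spectrum T r%:C -> `|p.[r]| <= c) -> bounded_by (op_poly p T) c.
Proof.
move=> Ts c0 pc x; have [->|x0] := eqVneq x 0; first by rewrite op0 !normR0 mulr0.
have [y y1 _] := unit_decomp x0.
have nt : exists x : H, normR x = 1 by exists y.
suff Nc : op_norm (op_poly p T) <= c.
  by apply: le_trans (bounded_by_op_norm _ _) _; rewrite ler_wpM2r ?normR_ge0.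
have [p0|p0] := eqVneq (p ^+ 2 - (op_norm (op_poly p T) ^+ 2)%:P) 0; last first.
  by have [r /pc + <-] := spectrum_poly_norm Ts nt p0.
have [r sr] := spectrum_neq0 Ts nt.
have := congr1 (fun p => p.[r]) p0; rewrite !hornerE => /eqP;
  rewrite subr_eq0 => /eqP pr.
rewrite -(ger0_norm (op_norm_ge0 _)) -ler_sqr ?nnegrE // real_normK ?num_real // -pr.
by rewrite -[leLHS]real_normK ?num_real // ler_sqr ?nnegrE // pc.
Qed.

(** * Continuous functional calculus on an interval *)

Lemma bounded_byW T c d : bounded_by T c -> c <= d -> bounded_by T d.
Proof.
by move=> Tc cd x; apply: le_trans (Tc x) _; rewrite ler_wpM2r ?normR_ge0.
Qed.

Lemma bounded_byD S T c d : bounded_by S c -> bounded_by T d ->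
  bounded_by (S + T) (c + d).
Proof.
by move=> Sc Td x; rewrite opE mulrDl; apply: le_trans (ler_normRD _ _) _;
  exact: lerD.
Qed.

Lemma bounded_byN T c : bounded_by T c -> bounded_by (- T) c.
Proof. by move=> Tc x; rewrite opE normRN. Qed.

Lemma bounded_byB S T c d : bounded_by S c -> bounded_by T d ->
  bounded_by (S - T) (c + d).
Proof. by move=> Sc /bounded_byN; exact: bounded_byD. Qed.

Lemma bounded_byM S T c d : 0 <= c -> bounded_by S c -> bounded_by T d ->
  bounded_by (S * T) (c * d).
Proof.
by move=> c0 Sc Td x; rewrite opE -mulrA (le_trans (Sc _)) // ler_wpM2l.
Qed.

Lemma bounded_by_eps T c K : 0 <= K ->
  (forall e, 0 < e -> bounded_by T (c + K * e)) -> bounded_by T c.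
Proof.
move=> K0 Tc x; apply/ler_addgt0Pr => e e0.
have d0 : 0 < K * normR x + 1 by rewrite ltr_wpDl ?mulr_ge0 ?normR_ge0.
apply: le_trans (Tc (e / (K * normR x + 1)) (divr_gt0 e0 d0) x) _.
rewrite mulrDl lerD2l mulrAC mulrA ler_pdivrMr // mulrC ler_pM2l //.
by rewrite lerDl.
Qed.

Lemma bounded_by0 T : bounded_by T 0 -> T = 0.
Proof.
move=> T0; apply: bopP => x; apply/eqP;
  rewrite zeroopE -normR_eq0 eq_le normR_ge0 andbT.
by have := T0 x; rewrite mul0r.
Qed.

Lemma bounded_by_eps0 T K : 0 <= K ->
  (forall e, 0 < e -> bounded_by T (K * e)) -> T = 0.
Proof.
move=> K0 Te; apply: bounded_by0; apply: bounded_by_eps K0 _ => e.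
rewrite add0r; exact: Te.
Qed.

Definition pos_bounded T M := posop T /\ bounded_by T M.

Lemma interval_poly_bound (p : {poly R}) T M c : pos_bounded T M -> 0 <= c ->
  (forall x : R, 0 <= x <= M -> `|p.[x]| <= c) -> bounded_by (op_poly p T) c.
Proof.
move=> [Tp TM] c0 pc; apply: op_poly_bound => //; first by case: Tp.
by move=> r sr; apply: pc; exact: pos_spectrum Tp TM sr.
Qed.

(** [S = f(T)], phrased as simultaneous polynomial approximation on the whole of
    [[0, M]] rather than on the spectrum.  For [T] positive and bounded by [M] it
    implies the calculus on the spectrum, while its algebraic rules are easier to
    prove. *)
Definition icalc M T (f : R -> R) S := forall e, 0 < e -> exists p : {poly R},
  (forall x : R, 0 <= x <= M -> `|p.[x] - f x| <= e) /\ bounded_by (op_poly p T - S) e.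

Lemma poly_bounded (p : {poly R}) M : exists2 K, 0 <= K &
  forall x : R, 0 <= x <= M -> `|p.[x]| <= K.
Proof.
exists (\sum_(i < size p) `|p`_i| * `|M| ^+ i).
  by apply: sumr_ge0 => i _; rewrite mulr_ge0 ?exprn_ge0.
move=> x /andP[x0 xM]; rewrite horner_coef; apply: le_trans (ler_norm_sum _ _ _) _.
apply: ler_sum => i _; rewrite normrM normrX ler_wpM2l //.
by rewrite lerXn2r ?nnegrE // (ger0_norm x0) (le_trans xM) // ler_norm.
Qed.

Lemma le0_inv_succ (z K : R) : 0 <= K -> (forall n, z <= K / n.+1%:R) -> z <= 0.
Proof.
move=> K0 zK; apply/ler_addgt0Pr => e e0; rewrite add0r.
by have [N /(_ _ (leqnn N))] := inv_succ_small K0 e0; exact: le_trans.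
Qed.

(** Linearity and boundedness survive the limit because the error is controlled
    by a multiple of [|x|] that tends to 0. *)
Lemma limit_op (u : nat -> 'B(H)) (g : H -> H) :
  (forall n x, normR (u n x - g x) <= 2 / n.+1%:R * normR x) ->
  exists S, forall x, S x = g x.
Proof.
move=> ug.
have small z K : 0 <= K -> (forall n, normR z <= K / n.+1%:R) -> z = 0.
  move=> K0 zK; apply/eqP; rewrite -normR_eq0 eq_le normR_ge0 andbT.
  exact: le0_inv_succ K0 zK.
have gZ (a : R[i]) x : g (a *: x) = a *: g x.
  apply/eqP; rewrite -subr_eq0; apply/eqP.
  apply: (@small _ (2 * normR (a *: x) + normR a * (2 * normR x))) => [|n].
    by rewrite addr_ge0 ?mulr_ge0 ?normR_ge0.
  have -> : g (a *: x) - a *: g x = a *: (u n x - g x) - (u n (a *: x) - g (a *: x)).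
    by rewrite opZ scalerBr opprB [RHS]addrC -!addrA addKr addrC.
  apply: le_trans (ler_normRD _ _) _; rewrite normRN normRZ addrC mulrDl.
  apply: lerD; first by apply: le_trans (ug _ _) _; rewrite mulrAC.
  by rewrite -mulrA ler_wpM2l ?normR_ge0 // (le_trans (ug _ _)) // mulrAC.
apply: (@real_linear_bop _ (op_norm (u 0%N) + 2)) => // [x y|x].
  apply/eqP; rewrite -subr_eq0; apply/eqP.
  apply: (@small _ (2 * normR x + 2 * normR y + 2 * normR (x + y))) => [|n].
    by rewrite !addr_ge0 ?mulr_ge0 ?normR_ge0.
  have -> : g (x + y) - (g x + g y) =
      (u n x - g x) + (u n y - g y) - (u n (x + y) - g (x + y)).
    by rewrite opD opprB [u n x - g x + _]addrACA -opprD [RHS]addrC addrA subrK.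
  have -> : (2 * normR x + 2 * normR y + 2 * normR (x + y)) / n.+1%:R =
      2 / n.+1%:R * normR x + 2 / n.+1%:R * normR y + 2 / n.+1%:R * normR (x + y).
    by ring.
  apply: le_trans (ler_normRD _ _) _; rewrite normRN lerD //.
  by apply: le_trans (ler_normRD _ _) _; rewrite lerD.
have -> : g x = u 0%N x - (u 0%N x - g x) by rewrite subKr.
apply: le_trans (ler_normRD _ _) _;
  rewrite normRN mulrDl lerD ?bounded_by_op_norm //.
by have := ug 0%N x; rewrite divr1.
Qed.

Section Calculus.
Variables (T : 'B(H)) (M : R) (TM : pos_bounded T M).
Implicit Types (f g : R -> R).

Lemma icalc_bounded f S : icalc M T f S -> exists2 K, 0 <= K &
  forall x : R, 0 <= x <= M -> `|f x| <= K.
Proof.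
move=> /(_ _ ltr01)[p [pf _]]; have [K K0 pK] := poly_bounded p M.
exists (K + 1) => [|x xM]; first by rewrite addr_ge0.
have -> : f x = p.[x] - (p.[x] - f x) by ring.
by apply: le_trans (ler_normB _ _) _; apply: lerD; [exact: pK|exact: pf].
Qed.

Lemma icalc_bound f S c : icalc M T f S -> 0 <= c ->
  (forall x : R, 0 <= x <= M -> `|f x| <= c) -> bounded_by S c.
Proof.
move=> fS c0 fc; apply: (@bounded_by_eps _ _ 2) => // e e0.
have [p [pf pS]] := fS e e0.
have -> : S = op_poly p T - (op_poly p T - S) by rewrite subKr.
have -> : c + 2 * e = (c + e) + e by ring.
apply: bounded_byB => //; apply: interval_poly_bound TM _ _;
  first by rewrite addr_ge0 // ltW.
move=> x xM; have -> : p.[x] = f x + (p.[x] - f x) by ring.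
by apply: le_trans (ler_normD _ _) _; apply: lerD; [exact: fc|exact: pf].
Qed.

Lemma icalc_ext f g S : (forall x : R, 0 <= x <= M -> f x = g x) ->
  icalc M T f S -> icalc M T g S.
Proof.
move=> fg fS e e0; have [p [pf pS]] := fS e e0; exists p; split=> // x xM.
by rewrite -fg // pf.
Qed.

Lemma icalc_poly (p : {poly R}) : icalc M T (fun r => p.[r]) (op_poly p T).
Proof.
move=> e e0; exists p; split=> [x _|]; first by rewrite subrr normr0 ltW.
by move=> x; rewrite subrr opE normR0 mulr_ge0 ?normR_ge0 // ltW.
Qed.

Lemma icalc_cst r : icalc M T (fun=> r) (r%:C *: Id).
Proof.
rewrite -(op_polyC _ T); apply: icalc_ext (icalc_poly _) => x _; exact: hornerC.
Qed.

Lemma icalc_id : icalc M T id T.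
Proof.
rewrite -[in X in icalc _ _ _ X](op_polyX T);
apply: icalc_ext (icalc_poly _) => x _; exact: hornerX.
Qed.

Lemma icalcD f g S S' : icalc M T f S -> icalc M T g S' ->
  icalc M T (fun r => f r + g r) (S + S').
Proof.
move=> fS gS e e0; have e20 : 0 < e / 2 by rewrite divr_gt0.
have [p [pf pS]] := fS _ e20; have [q [qg qS]] := gS _ e20.
exists (p + q); split=> [x xM|].
  rewrite hornerD opprD addrACA (splitr e) (le_trans (ler_normD _ _)) // lerD //.
    exact: pf.
  exact: qg.
by rewrite op_polyD opprD addrACA (splitr e); exact: bounded_byD.
Qed.

Lemma icalcM f g S S' : icalc M T f S -> icalc M T g S' ->
  icalc M T (fun r => f r * g r) (S * S').
Proof.
move=> fS gS e e0; have [K K0 fK] := icalc_bounded fS.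
have [L L0 gL] := icalc_bounded gS.
have KL0 : 0 < K + 1 + L by rewrite ltr_wpDr // ltr_wpDl.
(* Errors of at most [d] in both factors add up to [(K + 1) d + d L]. *)
pose d := Num.min 1 (e / (K + 1 + L)).
have d0 : 0 < d by rewrite lt_min ltr01 divr_gt0.
have d1 : d <= 1 by rewrite ge_min lexx.
have de : (K + 1) * d + d * L <= e.
  rewrite [d * L]mulrC -mulrDl mulrC -ler_pdivlMr // /d ge_min lexx orbT //.
have [p [pf pS]] := fS _ d0; have [q [qg qS]] := gS _ d0.
have pK (x : R) : 0 <= x <= M -> `|p.[x]| <= K + 1.
  move=> xM; have -> : p.[x] = f x + (p.[x] - f x) by ring.
  apply: le_trans (ler_normD _ _) _; apply: lerD; first exact: fK.
  by apply: le_trans d1; exact: pf.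
exists (p * q); split=> [x xM|].
  apply: le_trans de.
  have -> : (p * q).[x] - f x * g x = p.[x] * (q.[x] - g x) + (p.[x] - f x) * g x.
    by rewrite hornerM; ring.
  by rewrite (le_trans (ler_normD _ _)) // lerD // normrM ler_pM ?pK ?qg ?pf ?gL.
apply: bounded_byW de; rewrite op_polyM.
have -> : op_poly p T * op_poly q T - S * S' =
    op_poly p T * (op_poly q T - S') + (op_poly p T - S) * S'.
  by rewrite mulrBr mulrBl addrA subrK.
apply: bounded_byD; apply: bounded_byM => //.
- by rewrite addr_ge0.
- by apply: interval_poly_bound TM _ pK; rewrite addr_ge0.
- exact: ltW.
- exact: icalc_bound gS L0 gL.
Qed.

Lemma icalcZ c f S : icalc M T f S -> icalc M T (fun r => c * f r) (c%:C *: S).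
Proof. by move=> /(icalcM (icalc_cst c)); rewrite scaleopAl mul1r. Qed.

Lemma icalcB f g S S' : icalc M T f S -> icalc M T g S' ->
  icalc M T (fun r => f r - g r) (S - S').
Proof.
move=> fS /(icalcZ (-1)) gS; have := icalcD fS gS.
rewrite rmorphN scaleN1r; apply: icalc_ext => x _; ring.
Qed.

Lemma icalc_uniq f S S' : icalc M T f S -> icalc M T f S' -> S = S'.
Proof.
move=> fS fS'; apply/eqP; rewrite -subr_eq0; apply/eqP/bounded_by0.
by apply: icalc_bound (icalcB fS fS') (lexx _) _ => x _; rewrite subrr normr0.
Qed.

Lemma icalc_selfadj f S : icalc M T f S -> selfadj S.
Proof.
move=> fS x y; apply/eqP; rewrite -subr_eq0 -normr_le0; apply/ler_addgt0Pr => e e0.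
rewrite add0r; pose K := 2 * (normR x * normR y).
have K0 : 0 <= K by rewrite !mulr_ge0 ?normR_ge0.
have K1 : 0 < K + 1 by rewrite ltr_wpDl.
have [p [_ pS]] := fS _ (divr_gt0 e0 K1); set d := e / (K + 1) in pS.
have d0 : 0 <= d by rewrite divr_ge0 ?ltW.
have -> : ip (S x) y - ip x (S y) =
    ip x ((op_poly p T - S) y) - ip ((op_poly p T - S) x) y.
  rewrite !opE !ipBl !ipBr (selfadj_poly p (proj1 (proj1 TM)) x y); ring.
apply: le_trans (ler_normB _ _) _.
apply: (@le_trans _ _ (d * K)); last first.
  by rewrite mulrAC ler_pdivrMr // ler_pM2l // lerDl.
have -> : d * K = normR x * (d * normR y) + d * normR x * normR y.
  by rewrite /K; ring.
by apply: lerD; apply: le_trans (ler_ip _ _) _;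
  [rewrite ler_wpM2l ?normR_ge0|rewrite ler_wpM2r ?normR_ge0].
Qed.

(** The polynomials given by Weierstrass form a Cauchy sequence in operator norm. *)
Lemma icalc_exists f : continuous f -> exists S, icalc M T f S.
Proof.
move=> fc.
have [p pf] : {p : nat -> {poly R} &
    forall n (x : R), 0 <= x <= M -> `|(p n).[x] - f x| <= n.+1%:R^-1}.
  apply: (@choice _ _ (fun n p =>
    forall x : R, 0 <= x <= M -> `|p.[x] - f x| <= n.+1%:R^-1)) => n.
  by apply: weierstrass => //; rewrite invr_gt0.
pose u n := op_poly (p n) T.
have inv0 n : 0 < n.+1%:R^-1 :> R by rewrite invr_gt0.
have uu n m : (n <= m)%N -> bounded_by (u n - u m) (2 / n.+1%:R).
  move=> nm; rewrite /u -op_polyB; apply: interval_poly_bound TM _ _.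
    by rewrite divr_ge0.
  move=> x xM; rewrite hornerD hornerN.
  have -> : (p n).[x] - (p m).[x] = ((p n).[x] - f x) - ((p m).[x] - f x) by ring.
  rewrite (le_trans (ler_normB _ _)) // mulrDl mul1r lerD ?pf // (le_trans (pf _ _ _)) //.
  by rewrite lef_pV2 ?posrE // ler_nat ltnS.
have [g gP] : {g : H -> H & forall x, forall e, 0 < e ->
    exists N, forall n, (N <= n)%N -> normR (u n x - g x) <= e}.
  apply: (@choice _ _ (fun x l => forall e, 0 < e ->
    exists N, forall n, (N <= n)%N -> normR (u n x - l) <= e)) => x.
  apply: seq_complete => e e0.
  have x0 : 0 <= 2 * (2 * normR x) by rewrite !mulr_ge0 ?normR_ge0.
  have [N HN] := @inv_succ_small _ _ x0 e0.
  exists N => n m Nn Nm; apply: le_trans (HN N (leqnn _)).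
  have -> : u n x - u m x = (u N - u m) x - (u N - u n) x.
    by rewrite !opE opprB [RHS]addrC addrA subrK.
  apply: le_trans (ler_normRD _ _) _; rewrite normRN.
  apply: le_trans (lerD (uu _ _ Nm x) (uu _ _ Nn x)) _.
  by rewrite le_eqVlt; apply/orP; left; apply/eqP; ring.
have ug n x : normR (u n x - g x) <= 2 / n.+1%:R * normR x.
  apply/ler_addgt0Pr => e e0; have [N HN] := gP x e e0.
  have -> : u n x - g x = (u n - u (maxn n N)) x + (u (maxn n N) x - g x).
    by rewrite !opE addrA subrK.
  apply: le_trans (ler_normRD _ _) _; apply: lerD; first by rewrite uu ?leq_maxl.
  by rewrite HN ?leq_maxr.
have [S SE] := limit_op ug.
exists S => e e0; have [N HN] := @inv_succ_small 2 _ (ler0n _ _) e0.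
exists (p N); split=> [x xM|].
  apply: le_trans (pf _ _ xM) _; apply: le_trans (HN _ (leqnn _)).
  by rewrite -[leLHS]mul1r ler_wpM2r ?ler1n // ltW.
apply: bounded_byW (HN _ (leqnn _)) => x; rewrite !opE SE; exact: ug.
Qed.

(** A nonnegative continuous function is the square of its square root. *)
Lemma icalc_pos f S : continuous f -> (forall x : R, 0 <= x <= M -> 0 <= f x) ->
  icalc M T f S -> posop S.
Proof.
move=> fc f0 fS; split; first exact: icalc_selfadj fS.
have sc : continuous (fun r => Num.sqrt (f r)).
  move=> x; apply: (@continuous_comp _ _ _ f Num.sqrt); first exact: fc.
  exact: sqrt_continuous.
have [S' S'P] := icalc_exists sc.
have -> : S = S' * S'.
  apply: icalc_uniq fS _; apply: icalc_ext (icalcM S'P S'P) => x xM.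
  by rewrite -expr2 sqr_sqrtr // f0.
by move=> x; rewrite opE (icalc_selfadj S'P) ipxx sqr_ge0.
Qed.

End Calculus.

Lemma poly_intertwine A (P Q : 'B(H)) (p : {poly R}) : A * P = Q * A ->
  A * op_poly p P = op_poly p Q * A.
Proof.
move=> AP; elim/poly_ind: p => [|p c IH].
  by rewrite -[0]/(0%:P) !op_polyC scale0r mulr0 mul0r.
rewrite !op_polyD !op_polyM !op_polyX !op_polyC mulrDr mulrDl mulrA IH -mulrA AP mulrA.
by rewrite scaleopAr scaleopAl mulr1 mul1r.
Qed.

(** For polynomials the identity [A p(P) = p(Q) A] is algebraic; it passes to
    the limit. *)
Lemma icalc_intertwine A (P Q : 'B(H)) M (f : R -> R) S S' : pos_bounded Q M ->
  A * P = Q * A ->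
  icalc M P f S -> icalc M Q f S' -> A * S = S' * A.
Proof.
move=> QM AP fS fS'; have [K K0 AK] := exists_bounded_by A.
apply/eqP; rewrite -subr_eq0; apply/eqP.
apply: (@bounded_by_eps0 _ (4 * K)) => [|e e0]; first by rewrite mulr_ge0.
have [p [pf pS]] := fS _ e0; have [q [qf qS]] := fS' _ e0.
have -> : A * S - S' * A = (op_poly (p - q) Q * A + (op_poly q Q - S') * A)
    - A * (op_poly p P - S).
  rewrite op_polyB mulrBr (poly_intertwine _ AP) !mulrBl.
  by rewrite [_ - _ + (_ - _)]addrA subrK opprB [RHS]addrC addrA subrK.
have -> : 4 * K * e = 2 * e * K + e * K + K * e by ring.
have e0' := ltW e0.
apply: bounded_byB; last exact: bounded_byM.
apply: bounded_byD; apply: bounded_byM => //; first by rewrite mulr_ge0.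
apply: interval_poly_bound QM _ _ => [|x xM]; first by rewrite mulr_ge0.
rewrite hornerD hornerN;
  have -> : p.[x] - q.[x] = (p.[x] - f x) - (q.[x] - f x) by ring.
by rewrite (le_trans (ler_normB _ _)) // mulrDl mul1r lerD ?pf ?qf.
Qed.

(** Approximate [g] by [p] on [[0, M']], then [p \o h] by a polynomial on
    [[0, M]].  The case of interest is [(P^(1/2))^(2t) = P^t]. *)
Lemma icalc_comp T M M' (h g : R -> R) B S : pos_bounded T M ->
  (forall x : R, 0 <= x <= M -> 0 <= h x <= M') ->
  icalc M T h B -> icalc M' B g S -> icalc M T (g \o h) S.
Proof.
move=> TM hM' hB gS e e0; have e20 : 0 < e / 2 by rewrite divr_gt0.
have ph (p : {poly R}) : icalc M T (fun r => p.[h r]) (op_poly p B).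
  elim/poly_ind: p => [|p c IH].
    rewrite -[0]/(0%:P) op_polyC; apply: icalc_ext (@icalc_cst T M _) => x _.
    by rewrite hornerC.
  rewrite op_polyD op_polyM op_polyX op_polyC.
  apply: icalc_ext (icalcD (icalcM TM IH hB) (@icalc_cst T M c)) => x _.
  by rewrite !hornerE.
have [p [pg pS]] := gS _ e20; have [q [qp qS]] := ph p _ e20.
exists q; split=> [x xM|].
  have -> : q.[x] - (g \o h) x = (q.[x] - p.[h x]) + (p.[h x] - g (h x)).
    by rewrite /=; ring.
  rewrite (splitr e) (le_trans (ler_normD _ _)) // lerD //; first exact: qp.
  by apply: pg; exact: hM'.
have -> : op_poly q T - S = (op_poly q T - op_poly p B) + (op_poly p B - S).
  by rewrite addrA subrK.
by rewrite (splitr e); exact: bounded_byD.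
Qed.

Lemma uniform_cvgP (A : set R) (F : nat -> R -> R) (f : R -> R) :
  {uniform A, F @ \oo --> f} <->
  forall e, 0 < e -> exists N, forall n, (N <= n)%N ->
    forall x : R, A x -> `|F n x - f x| <= e.
Proof.
split=> [Ff e e0|Ff P].
  have [|N _ HN] := Ff [set h | forall y : R, A y -> `|f y - h y| < e].
    apply/uniform_nbhs; exists [set xy | ball xy.1 e xy.2]; split; last by [].
    by rewrite -entourage_ballE; exists e.
  by exists N => n Nn x Ax; rewrite distrC ltW // (HN n).
move=> /uniform_nbhs[E [/= + EP]]; rewrite -entourage_ballE => -[e /= e0 eE].
have e20 : 0 < e / 2 by rewrite divr_gt0.
have [N HN] := Ff _ e20.
exists N => // n /= Nn; apply: EP => y Ay; apply: eE => /=.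
rewrite /ball /= distrC; apply: le_lt_trans (HN _ Nn _ Ay) _.
by rewrite ltr_pdivrMr // ltr_pMr ?ltr1n.
Qed.

(** The interval [[0, M]] contains the real spectrum, where any two sequences of
    polynomials converging to [f] become uniformly close; by the spectral norm
    bound so do their values at [T]. *)
Lemma icalc_is_fcalc T M (f : R -> R) S : pos_bounded T M -> icalc M T f S ->
  is_fcalc T f S.
Proof.
move=> TM fS p /uniform_cvgP pf; apply/cvgrPdist_le => e e0.
have e40 : 0 < e / 3 by rewrite divr_gt0.
have [N HN] := pf _ e40; have [q [qf qS]] := fS _ e40.
exists N => // n /= Nn; rewrite sub0r normrN ger0_norm ?op_norm_ge0 //.
apply: op_norm_le; first exact: ltW.
have -> : op_poly (p n) T - S = op_poly (p n - q) T + (op_poly q T - S).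
  by rewrite op_polyB addrA subrK.
have -> : e = (2 * (e / 3)) + e / 3 by field.
apply: bounded_byD => //; apply: op_poly_bound; first exact: proj1 (proj1 TM).
  by rewrite mulr_ge0 // ltW.
move=> r sr; have rM := pos_spectrum (proj1 TM) (proj2 TM) sr.
rewrite hornerD hornerN.
have -> : (p n).[r] - q.[r] = ((p n).[r] - f r) - (q.[r] - f r) by ring.
rewrite (le_trans (ler_normB _ _)) // mulrDl mul1r lerD ?qf //.
by apply: HN Nn _ _.
Qed.

Lemma icalc_fcalc T M (f : R -> R) S : pos_bounded T M -> icalc M T f S ->
  fcalc T f = S.
Proof.
move=> TM fS; have fcS := icalc_is_fcalc TM fS.
have fcF : is_fcalc T f (fcalc T f).
  by apply: (xgetPex 0 (P := is_fcalc T f)); exists S.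
have [p pP] : {p : nat -> {poly R} &
    forall n (x : R), 0 <= x <= M -> `|(p n).[x] - f x| <= n.+1%:R^-1}.
  apply: (@choice _ _ (fun n p =>
    forall x : R, 0 <= x <= M -> `|p.[x] - f x| <= n.+1%:R^-1)) => n.
  have n0 : 0 < n.+1%:R^-1 :> R by rewrite invr_gt0.
  by have [q [qf _]] := fS _ n0; exists q.
have pf : {uniform [set x : R | spectrum T x%:C],
    (fun n r => (p n).[r]) @ \oo --> f}.
  apply/uniform_cvgP => e e0; have [N HN] := @inv_succ_small 1 _ ler01 e0.
  exists N => n Nn x sx; apply: le_trans (pP _ _ _) _.
    exact: pos_spectrum (proj1 TM) (proj2 TM) sx.
  by rewrite -[leLHS]mul1r; exact: HN.
apply/eqP; rewrite -subr_eq0; apply/eqP; apply: (@bounded_by_eps0 _ 2) => // e e0.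
have := fcS p pf; have := fcF p pf.
move=> /cvgrPdist_le/(_ _ e0)[N1 _ H1] /cvgrPdist_le/(_ _ e0)[N2 _ H2].
pose n := maxn N1 N2.
have := H1 n (leq_maxl _ _); have := H2 n (leq_maxr _ _).
rewrite /= !sub0r !normrN !ger0_norm ?op_norm_ge0 // => SN FN.
have -> : fcalc T f - S = (op_poly (p n) T - S) - (op_poly (p n) T - fcalc T f).
  by rewrite opprB [RHS]addrC addrA subrK.
rewrite mulrDl mul1r; apply: bounded_byB;
  apply: bounded_byW (@bounded_by_op_norm _) _ => //.
Qed.

(** * Powers of the absolute value of an operator *)

Lemma ip_adj A x y : ip (op_adj dot A x) y = ip x (A y).
Proof. by rewrite ipC -op_adjP ipC. Qed.

Lemma bounded_by_adj A K : 0 <= K -> bounded_by A K -> bounded_by (op_adj dot A) K.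
Proof.
move=> K0 AK y; set z := op_adj dot A y.
have [->|z0] := eqVneq (normR z) 0; first by rewrite mulr_ge0 ?normR_ge0.
have zp : 0 < normR z by rewrite lt_def z0 normR_ge0.
rewrite -(ler_pM2r zp) -expr2 -ipxx {1}/z ip_adj.
apply: le_trans (ler_norm _) _; apply: le_trans (ler_ip _ _) _.
by rewrite [K * _]mulrC -mulrA ler_wpM2l ?normR_ge0.
Qed.

Lemma ip_gram A x y : ip ((op_adj dot A * A) x) y = ip (A x) (A y).
Proof. by rewrite opE ip_adj. Qed.

Lemma posop_gram A : posop (op_adj dot A * A).
Proof.
split=> [x y|x]; last by rewrite ip_gram ipxx sqr_ge0.
by rewrite ip_gram ipC -ip_gram ipC.
Qed.

Lemma pos_bounded_gram A K : 0 <= K -> bounded_by A K ->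
  pos_bounded (op_adj dot A * A) (K ^+ 2).
Proof.
by move=> K0 AK; split;
  [exact: posop_gram|apply: bounded_byM (bounded_by_adj _ _) _].
Qed.

(** For nonnegative exponents the identity also holds at [r = 0], since
    [0 `^ 0 = 1]. *)
Lemma powRD_ge0 (r s t : R) : 0 <= s -> 0 <= t -> r `^ (s + t) = r `^ s * r `^ t.
Proof.
move=> s0 t0; have [st0|st0] := eqVneq (s + t) 0;
  last by rewrite powRD // (negPf st0).
have s00 : s = 0 by lra. have t00 : t = 0 by lra.
by rewrite s00 t00 addr0 powRr0 mulr1.
Qed.

Lemma op_pow_icalc T M s : pos_bounded T M -> 0 <= s ->
  icalc M T (fun r => r `^ s) (op_pow T s) /\ posop (op_pow T s).
Proof.
move=> TM s0; have fc := @continuous_norm_powR R s s0.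
have [S fS] := icalc_exists TM fc.
have fS' : icalc M T (fun r => r `^ s) S.
  by apply: icalc_ext fS => r /andP[r0 _]; rewrite ger0_norm.
rewrite (icalc_fcalc TM fS' : op_pow T s = S); split=> //.
by apply: (icalc_pos TM fc _ fS) => r _; exact: powR_ge0.
Qed.

(** The bound on the absolute value is what allows one to apply the
    calculus to it again. *)
Lemma op_abs_icalc A K : 0 <= K -> bounded_by A K ->
  icalc (K ^+ 2) (op_adj dot A * A) (fun r => r `^ 2^-1) (op_abs dot A) /\
  pos_bounded (op_abs dot A) K.
Proof.
move=> K0 AK; have PM := pos_bounded_gram K0 AK.
have h0 : 0 <= 2^-1 :> R by rewrite invr_ge0.
have [fS pS] := op_pow_icalc PM h0; split=> //; split=> //.
apply: (icalc_bound PM fS K0) => r /andP[r0 rK]; rewrite ger0_norm ?powR_ge0 //.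
have -> : K = (K ^+ 2) `^ 2^-1 by rewrite powR12_sqrt ?sqr_ge0 // sqrtr_sqr ger0_norm.
by rewrite ge0_ler_powR // nnegrE ?sqr_ge0.
Qed.

Lemma op_pow_abs_icalc A K t : 0 <= K -> bounded_by A K -> 0 <= t ->
  icalc (K ^+ 2) (op_adj dot A * A) (fun r => r `^ t)
    (op_pow (op_abs dot A) (2 * t)) /\
  posop (op_pow (op_abs dot A) (2 * t)).
Proof.
move=> K0 AK t0; have PM := pos_bounded_gram K0 AK.
have [hB BK] := op_abs_icalc K0 AK.
have [gS pS] := op_pow_icalc BK (mulr_ge0 (ler0n _ 2) t0); split; last exact: pS.
have bound : forall r : R, 0 <= r <= K ^+ 2 -> 0 <= r `^ 2^-1 <= K.
  move=> r /andP[r0 rK]; rewrite powR_ge0 /=.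
  have -> : K = (K ^+ 2) `^ 2^-1 by rewrite powR12_sqrt ?sqr_ge0 // sqrtr_sqr ger0_norm.
  by rewrite ge0_ler_powR // ?nnegrE ?sqr_ge0 // invr_ge0.
apply: icalc_ext (icalc_comp PM bound hB gS) => r _ /=.
by rewrite -powRrM mulKf.
Qed.

Lemma op_pow_abs_double A t : 0 <= t ->
  op_pow (op_abs dot A) (4 * t) =
  op_pow (op_abs dot A) (2 * t) * op_pow (op_abs dot A) (2 * t).
Proof.
move=> t0; have [K K0 AK] := exists_bounded_by A; have PM := pos_bounded_gram K0 AK.
have [B1 _] := op_pow_abs_icalc K0 AK (mulr_ge0 (ler0n _ 2) t0).
have [B2 _] := op_pow_abs_icalc K0 AK t0.
have -> : 4 * t = 2 * (2 * t) by ring.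
apply: (icalc_uniq PM B1); apply: icalc_ext (icalcM PM B2 B2) => r _.
by rewrite -powRD_ge0 // mulr_natl mulr2n.
Qed.

Lemma op_pow_abs1 A : op_pow (op_abs dot A) 1 = op_abs dot A.
Proof.
have [K K0 AK] := exists_bounded_by A; have PM := pos_bounded_gram K0 AK.
have h0 : 0 <= 2^-1 :> R by rewrite invr_ge0.
have [] := op_pow_abs_icalc K0 AK h0; rewrite divff // => B1 _.
by have [B2 _] := op_abs_icalc K0 AK; exact: (icalc_uniq PM B1 B2).
Qed.

Lemma op_pow_abs2 A : op_pow (op_abs dot A) 2 = op_adj dot A * A.
Proof.
have [K K0 AK] := exists_bounded_by A; have PM := pos_bounded_gram K0 AK.
have [] := op_pow_abs_icalc K0 AK ler01; rewrite mulr1 => B1 _.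
apply: (icalc_uniq PM B1); apply: icalc_ext (@icalc_id _ (K ^+ 2)) => r /andP[r0 _].
by rewrite powRr1.
Qed.

(** * The mixed Schwarz and Buzano inequalities *)

Lemma ip_phase (u : R[i]) x y : normR u = 1 -> ip (u *: x) (u *: y) = ip x y.
Proof.
move=> u1; rewrite /ip linearZl_LR linearZr_LR /= mulrA.
by rewrite -normCK normRE u1 expr1n mul1r.
Qed.

(** The reflection of [x] through the line of [z] has the same norm as [x]; apply
    Cauchy-Schwarz to it and [y]. *)
Lemma buzano x y z : normR z = 1 ->
  ip x z * ip z y <= 2^-1 * (normR x * normR y + `|ip x y|).
Proof.
move=> z1; pose x' := (2 * ip x z)%:C *: z - x.
have nx' : normR x' = normR x.
  apply/eqP; rewrite -(@eqrXn2 _ 2) ?normR_ge0 //; apply/eqP.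
  rewrite normR_sqrB normRZ normR_real z1 mulr1 ipZl (ipC z x) real_normK ?num_real //.
  by ring.
have := ler_ip x' y; rewrite nx' /x' ipBl ipZl => /(le_trans (ler_norm _)).
by have := ler_norm (ip x y); lra.
Qed.

Section MixedSchwarz.
Variables (A B C : 'B(H)) (M t : R).
Hypotheses (t01 : 0 <= t <= 1).
Hypotheses (PM : pos_bounded (op_adj dot A * A) M).
Hypotheses (QM : pos_bounded (A * op_adj dot A) M).
Hypotheses (BP : icalc M (op_adj dot A * A) (fun r => r `^ t) B) (Bpos : posop B).
Hypotheses (CQ : icalc M (A * op_adj dot A) (fun r => r `^ (1 - t)) C).
Hypotheses (Cpos : posop C).

Let t0 : 0 <= t. Proof. by case/andP: t01. Qed.
Let t1 : 0 <= 1 - t. Proof. by rewrite subr_ge0; case/andP: t01. Qed.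

(** The regularisation [U = B + e] is invertible, with inverse
    [V = fe(A^* A)] for [fe r = (r^t + e)^(-1)].  With [Q = A A^*], Cauchy-Schwarz
    for the form of [U] and the relation [A V = fe(Q) A] reduce the claim to the
    positivity of [C - fe(Q) Q], i.e. to [r / (r^t + e) <= r^(1-t)]. *)
Lemma mixed_schwarz_eps e x y : 0 < e ->
  ip (A x) y ^+ 2 <= (ip (B x) x + e * normR x ^+ 2) * ip (C y) y.
Proof.
move=> e0; pose fe (r : R) := (`|r| `^ t + e)^-1.
have fe_gt0 r : 0 < `|r| `^ t + e by rewrite ltr_wpDl ?powR_ge0.
have fe_cont : continuous fe.
  move=> r; apply: cvgV; first by rewrite gt_eqF.
  by apply: cvgD; [exact: continuous_norm_powR|exact: cvg_cst].
have [V VP] := icalc_exists PM fe_cont; have [V' VQ] := icalc_exists QM fe_cont.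
pose U := B + e%:C *: Id.
have UV : U * V = 1.
  apply: (icalc_uniq PM) (icalcM PM (icalcD BP (@icalc_cst _ M e)) VP) _.
  rewrite -[X in icalc _ _ _ X]scale1r -[1]/(1%:C).
  apply: icalc_ext (@icalc_cst _ M 1) => r /andP[r0 _].
  by rewrite /fe ger0_norm // mulfV // gt_eqF // ltr_wpDl ?powR_ge0.
have Us : selfadj U by apply: selfadjD; [case: Bpos|exact: selfadjZ].
have Ux : ip (U x) x = ip (B x) x + e * normR x ^+ 2 by rewrite !opE ipDl ipZl ipxx.
have Upos : posop U.
  split=> // z; rewrite !opE ipDl ipZl ipxx addr_ge0 ?(proj2 Bpos) //.
  by rewrite mulr_ge0 ?sqr_ge0 // ltW.
pose z := op_adj dot A y.
have -> : ip (A x) y = ip (U x) (V z) by rewrite Us -mulopE UV oneopE op_adjP.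
apply: le_trans (pos_cauchy_schwarz Upos _ _) _; rewrite Ux; apply: ler_wpM2l.
  by rewrite -Ux; exact: (proj2 Upos).
rewrite -mulopE UV oneopE /z ip_adj -(mulopE A).
have AP : A * (op_adj dot A * A) = (A * op_adj dot A) * A by rewrite mulrA.
rewrite (icalc_intertwine QM AP VP VQ) -(mulopE (V' * A)) -mulrA.
set Q := A * op_adj dot A; rewrite -subr_ge0 (ipC y) -ipBl -oppopE -addopE.
have hcont : continuous (fun r => `|r| `^ (1 - t) - fe r * r).
  move=> r; apply: cvgB; first exact: continuous_norm_powR.
  by apply: cvgM; [exact: fe_cont|exact: cvg_id].
have diff : icalc M Q (fun r => `|r| `^ (1 - t) - fe r * r) (C - V' * Q).
  apply: icalc_ext (icalcB QM CQ (icalcM QM VQ (@icalc_id _ _))) => r /andP[r0 _].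
  by rewrite ger0_norm.
apply: (proj2 (icalc_pos QM hcont _ diff)) => r /andP[r0 _].
rewrite subr_ge0 /fe ger0_norm // mulrC ler_pdivrMr;
  last by rewrite ltr_wpDl ?powR_ge0.
by rewrite mulrDr -powRD_ge0 // subrK powRr1 // lerDl mulr_ge0 ?powR_ge0 // ltW.
Qed.

Lemma mixed_schwarz x y : ip (A x) y ^+ 2 <= ip (B x) x * ip (C y) y.
Proof.
have c0 := proj2 Cpos y; apply/ler_addgt0Pr => e e0.
have n0 : 0 <= normR x ^+ 2 * ip (C y) y by rewrite mulr_ge0 // sqr_ge0.
have d0 : 0 < normR x ^+ 2 * ip (C y) y + 1 by rewrite ltr_wpDl.
apply: le_trans (mixed_schwarz_eps x y (divr_gt0 e0 d0)) _.
rewrite mulrDl lerD2l -mulrA mulrAC.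
by rewrite ler_pdivrMr // ler_pM2l // lerDl.
Qed.

Lemma mixed_schwarz_dot x : normR (dot (A x) x) ^+ 2 <= ip (B x) x * ip (C x) x.
Proof.
have [u u1 ->] := dot_phase (A x) x; rewrite -opZ.
apply: le_trans (mixed_schwarz _ _) _; rewrite (opZ B) ip_phase //.
Qed.

Lemma mixed_buzano x : normR x = 1 ->
  normR (dot (A x) x) ^+ 2 <=
    2^-1 * (normR (C x) * normR (B x) + normR (dot ((B * C) x) x)).
Proof.
move=> x1; apply: le_trans (mixed_schwarz_dot x) _.
rewrite mulrC (ipC (B x)); apply: le_trans (buzano _ _ x1) _.
rewrite ler_pM2l ?invr_gt0 // lerD2l opE.
by apply: le_trans (ler_ip_dot _ _); rewrite (proj1 Bpos).
Qed.

End MixedSchwarz.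

Lemma ler_normR_dot x y : normR (dot x y) <= normR x * normR y.
Proof.
have [u u1 ->] := dot_phase x y; apply: le_trans (ler_norm _) _.
by apply: le_trans (ler_ip _ _) _; rewrite normRZ u1 mul1r.
Qed.

Lemma mixed_buzano_abs A t x : 0 <= t <= 1 -> normR x = 1 ->
  normR (dot (A x) x) ^+ 2 <=
    2^-1 * (normR (op_pow (op_abs dot (op_adj dot A)) (2 * (1 - t)) x) *
            normR (op_pow (op_abs dot A) (2 * t) x) +
            normR (dot ((op_pow (op_abs dot A) (2 * t) *
              op_pow (op_abs dot (op_adj dot A)) (2 * (1 - t))) x) x)).
Proof.
move=> t01; have /andP[t0 t1] := t01; have t1' : 0 <= 1 - t by rewrite subr_ge0.
have [K K0 AK] := exists_bounded_by A; have AK' := bounded_by_adj K0 AK.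
have PM := pos_bounded_gram K0 AK; have QM := pos_bounded_gram K0 AK'.
have [BP Bpos] := op_pow_abs_icalc K0 AK t0.
have [CQ Cpos] := op_pow_abs_icalc K0 AK' t1'.
rewrite (op_adjK A) in QM CQ.
exact: (mixed_buzano t01 PM QM BP Bpos CQ Cpos).
Qed.

(** * Euclidean norm and Euclidean radius of a tuple *)

Lemma sum_cauchy_schwarz d (a b : 'I_d -> R) :
  \sum_(k < d) a k * b k <=
  Num.sqrt (\sum_(k < d) a k ^+ 2) * Num.sqrt (\sum_(k < d) b k ^+ 2).
Proof.
rewrite -sqrtrM ?sumr_ge0 // => [|k _]; last exact: sqr_ge0.
apply: le_trans (ler_norm _) _; rewrite -sqrtr_sqr ler_wsqrtr //.
apply: quadratic_ge0 => s.
have : 0 <= \sum_(k < d) (a k + s * b k) ^+ 2.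
  by apply: sumr_ge0 => k _; exact: sqr_ge0.
have -> : \sum_(k < d) (a k + s * b k) ^+ 2 =
   \sum_(k < d) (a k ^+ 2 + 2 * s * (a k * b k) + s ^+ 2 * b k ^+ 2).
  by apply: eq_bigr => k _; ring.
by rewrite !big_split /= -!mulr_sumr.
Qed.

Section Tuples.
Variable d : nat.
Implicit Types D G : 'I_d -> 'B(H).

Lemma euclidean_op_norm_bounded D x : normR x = 1 ->
  Num.sqrt (\sum_(k < d) normR (D k x) ^+ 2) <=
  Num.sqrt (\sum_(k < d) op_norm (D k) ^+ 2).
Proof.
move=> x1; apply/ler_wsqrtr/ler_sum => k _.
rewrite ler_sqr ?nnegrE ?normR_ge0 ?op_norm_ge0 //.
exact: bounded_by_unit (@bounded_by_op_norm _) _ x1.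
Qed.

Lemma euclidean_op_norm_ub D x : normR x = 1 ->
  Num.sqrt (\sum_(k < d) normR (D k x) ^+ 2) <= euclidean_op_norm D.
Proof. exact/unit_sup_ub/euclidean_op_norm_bounded. Qed.

Lemma euclidean_op_radius_ub D x : normR x = 1 ->
  Num.sqrt (\sum_(k < d) normR (dot (D k x) x) ^+ 2) <= euclidean_op_radius dot D.
Proof.
apply: (@unit_sup_ub (fun x => Num.sqrt (\sum_(k < d) normR (dot (D k x) x) ^+ 2))
  (Num.sqrt (\sum_(k < d) op_norm (D k) ^+ 2))) => z z1.
apply: le_trans (euclidean_op_norm_bounded D z1); apply/ler_wsqrtr/ler_sum => k _.
rewrite ler_sqr ?nnegrE ?normR_ge0 // (le_trans (ler_normR_dot _ _)) // z1 mulr1 //.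
Qed.

Lemma euclidean_op_norm_ge0 D : 0 <= euclidean_op_norm D.
Proof.
by apply: (unit_sup_ge0 (euclidean_op_norm_bounded D)) => x; exact: sqrtr_ge0.
Qed.

(** The sum [S] of the [G k] is positive and [<S x, x>] is the sum of the
    [|D k x|^2], so the claim is that the norm of a positive operator is the
    supremum of its quadratic form.  Cauchy-Schwarz for the form of [S] at [x] and
    [S x] gives the nontrivial half. *)
Lemma euclidean_op_norm_gram D G :
  (forall k x y, ip (G k x) y = ip (D k x) (D k y)) ->
  euclidean_op_norm D = Num.sqrt (op_norm (\sum_(k < d) G k)).
Proof.
move=> GD; set S := \sum_(k < d) G k; set N := euclidean_op_norm D.
have N0 : 0 <= N := euclidean_op_norm_ge0 D.
have ipS x y : ip (S x) y = \sum_(k < d) ip (D k x) (D k y).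
  rewrite /S sumopE; elim/big_rec2: _ => [|k a z _ <-]; first by rewrite ip0l.
  by rewrite ipDl GD.
have ipSxx x : ip (S x) x = \sum_(k < d) normR (D k x) ^+ 2.
  by rewrite ipS; apply: eq_bigr => k _; rewrite ipxx.
have Spos : posop S.
  split=> [x y|x]; last by rewrite ipSxx sumr_ge0 // => k _; exact: sqr_ge0.
  by rewrite ipS (ipC x) ipS; apply: eq_bigr => k _; rewrite ipC.
apply/eqP; rewrite eq_le; apply/andP; split.
  apply: unit_sup_le => [|x x1]; first exact: sqrtr_ge0.
  rewrite -ipSxx ler_wsqrtr // (le_trans (ler_norm _)) //.
  by apply: le_trans (bounded_by_ip _ (@bounded_by_op_norm S)) _;
    rewrite x1 expr1n mulr1.
have SN x : ip (S x) x <= N ^+ 2 * normR x ^+ 2.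
  have [->|x0] := eqVneq x 0; first by rewrite ip0r mulr_ge0 ?sqr_ge0.
  have [y y1 ->] := unit_decomp x0.
  rewrite opZ ipZl ipZr normRZ normR_real y1 mulr1 real_normK ?num_real //.
  rewrite mulrA -expr2 mulrC ler_wpM2r ?sqr_ge0 // ipSxx.
  rewrite -ler_sqrt ?sqr_ge0 // sqrtr_sqr ger0_norm //.
  exact: euclidean_op_norm_ub.
rewrite -(ger0_norm N0) -sqrtr_sqr ler_wsqrtr //.
apply: op_norm_le => [|x]; first exact: sqr_ge0.
have [->|Sx0] := eqVneq (normR (S x)) 0;
  first by rewrite mulr_ge0 ?sqr_ge0 ?normR_ge0.
have Sxp : 0 < normR (S x) by rewrite lt_def Sx0 normR_ge0.
rewrite -ler_sqr ?nnegrE ?mulr_ge0 ?sqr_ge0 ?normR_ge0 //.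
have Sx2 : 0 < normR (S x) ^+ 2 by rewrite exprn_gt0.
rewrite -(ler_pM2r Sx2) -expr2 -{1}ipxx.
apply: le_trans (pos_cauchy_schwarz Spos _ _) _.
rewrite exprMn -mulrA [N ^+ 2 ^+ 2]expr2.
have -> : N ^+ 2 * N ^+ 2 * (normR x ^+ 2 * normR (S x) ^+ 2) =
  (N ^+ 2 * normR x ^+ 2) * (N ^+ 2 * normR (S x) ^+ 2) by ring.
by rewrite ler_pM ?SN //; exact: (proj2 Spos).
Qed.

(** Cauchy-Schwarz in [R^d] for each of the two sums; the second one is paired
    with the constant sequence 1, whose norm is [sqrt d]. *)
Lemma euclidean_op_radius_bound (A B C : 'I_d -> 'B(H)) :
  (forall k x, normR x = 1 -> normR (dot (A k x) x) ^+ 2 <=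
     2^-1 * (normR (C k x) * normR (B k x) + normR (dot ((B k * C k) x) x))) ->
  euclidean_op_radius dot A <=
  Num.sqrt (2^-1 * (euclidean_op_norm C * euclidean_op_norm B) +
    Num.sqrt d%:R / 2 * euclidean_op_radius dot (B \* C)).
Proof.
move=> ABC; apply: unit_sup_le => [|x x1]; first exact: sqrtr_ge0.
apply: ler_wsqrtr.
apply: (@le_trans _ _ (\sum_(k < d) 2^-1 *
    (normR (C k x) * normR (B k x) + normR (dot ((B \* C) k x) x)))).
  by apply: ler_sum => k _; exact: ABC.
rewrite -mulr_sumr big_split /= mulrDr lerD //.
  rewrite ler_pM2l ?invr_gt0 //; apply: le_trans (sum_cauchy_schwarz _ _) _.
  by rewrite ler_pM ?sqrtr_ge0 //; exact: euclidean_op_norm_ub.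
rewrite [Num.sqrt _ / 2]mulrC -mulrA ler_pM2l ?invr_gt0 //.
apply: (@le_trans _ _ (\sum_(k < d) 1 * normR (dot ((B \* C) k x) x))).
  by apply: ler_sum => k _; rewrite mul1r.
apply: le_trans (sum_cauchy_schwarz _ _) _.
under eq_bigr do rewrite expr1n;
  rewrite sumr_const card_ord ler_wpM2l ?sqrtr_ge0 //.
exact: euclidean_op_radius_ub.
Qed.

Lemma euclidean_op_radius_bound_abs (A : 'I_d -> 'B(H)) t : 0 <= t <= 1 ->
  euclidean_op_radius dot A <=
  Num.sqrt (2^-1 *
      (euclidean_op_norm (tuple_pow (tuple_abs dot (tuple_adj dot A)) (2 * (1 - t))) *
       euclidean_op_norm (tuple_pow (tuple_abs dot A) (2 * t))) +
    Num.sqrt d%:R / 2 * euclidean_op_radius dot (tuple_pow (tuple_abs dot A) (2 * t) \*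
      tuple_pow (tuple_abs dot (tuple_adj dot A)) (2 * (1 - t)))).
Proof.
by move=> t01; apply: euclidean_op_radius_bound => k x; exact: mixed_buzano_abs.
Qed.

Lemma euclidean_op_norm_pow_abs (A : 'I_d -> 'B(H)) t : 0 <= t ->
  euclidean_op_norm (tuple_pow (tuple_abs dot A) (2 * t)) =
  Num.sqrt (op_norm (\sum_(k < d) tuple_pow (tuple_abs dot A) (4 * t) k)).
Proof.
move=> t0; apply: euclidean_op_norm_gram => k x y; rewrite /tuple_pow /tuple_abs.
rewrite op_pow_abs_double // mulopE.
have [K K0 AK] := exists_bounded_by (A k);
  have [_ [Bs _]] := op_pow_abs_icalc K0 AK t0.
exact: Bs.
Qed.

Lemma tuple_pow_abs1 (A : 'I_d -> 'B(H)) :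
  tuple_pow (tuple_abs dot A) 1 = tuple_abs dot A.
Proof. by apply/funext => k; exact: op_pow_abs1. Qed.

Lemma euclidean_op_norm_abs2 (A : 'I_d -> 'B(H)) : euclidean_op_norm A =
  Num.sqrt (op_norm (\sum_(k < d) tuple_pow (tuple_abs dot A) 2 k)).
Proof.
apply: euclidean_op_norm_gram => k x y.
by rewrite /tuple_pow /tuple_abs op_pow_abs2 ip_gram.
Qed.

(** [|A|] and [A] have the same Gram operator, [A^* A]. *)
Lemma euclidean_op_norm_abs (A : 'I_d -> 'B(H)) :
  euclidean_op_norm (tuple_abs dot A) = euclidean_op_norm A.
Proof.
rewrite (euclidean_op_norm_abs2 A) -[in LHS](tuple_pow_abs1 A).
have h0 : 0 <= 2^-1 :> R by rewrite invr_ge0.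
have := euclidean_op_norm_pow_abs A h0.
have -> : 4 * 2^-1 = 2 :> R by field.
by rewrite divff.
Qed.

Lemma euclidean_op_radius_bound_half (A : 'I_d -> 'B(H)) :
  euclidean_op_radius dot A <=
  Num.sqrt (2^-1 * (euclidean_op_norm (tuple_adj dot A) * euclidean_op_norm A) +
    Num.sqrt d%:R / 2 * euclidean_op_radius dot
      (tuple_abs dot A \* tuple_abs dot (tuple_adj dot A))).
Proof.
have h01 : 0 <= (2^-1 : R) <= 1 by lra.
have := euclidean_op_radius_bound_abs A h01.
have -> : 2 * (1 - 2^-1) = 1 :> R by field.
have -> : 2 * 2^-1 = 1 :> R by field.
by rewrite !tuple_pow_abs1 !euclidean_op_norm_abs.
Qed.

End Tuples.

End InnerProduct.

Theorem corollary2p8 (R : realType) (H : completeNormedModType R[i])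
    (dot : {dot H for Num.conj}) (norm_dot : forall x : H, `|x| ^+ 2 = dot x x)
    (d : nat) (d_ge1 : (1 <= d)%N) (A : 'I_d -> 'B(H)) :
  let As := tuple_adj dot A in
  let absA := tuple_abs dot A in
  let absAs := tuple_abs dot As in
  let w_e := euclidean_op_radius dot (d := d) in
  (forall t : R, 0 <= t <= 1 ->
    let E1 :=
      2^-1 * (euclidean_op_norm (tuple_pow absAs (2 * (1 - t))) *
              euclidean_op_norm (tuple_pow absA (2 * t))) +
      Num.sqrt d%:R / 2 *
        w_e (tuple_pow absA (2 * t) \* tuple_pow absAs (2 * (1 - t))) in
    let E2 :=
      2^-1 * (Num.sqrt (op_norm (\sum_(k < d) tuple_pow absAs (4 * (1 - t)) k)) *
              Num.sqrt (op_norm (\sum_(k < d) tuple_pow absA (4 * t) k))) +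
      Num.sqrt d%:R / 2 *
        w_e (tuple_pow absA (2 * t) \* tuple_pow absAs (2 * (1 - t))) in
    w_e A <= Num.sqrt E1 /\ Num.sqrt E1 = Num.sqrt E2) /\
  (let F1 :=
     2^-1 * (euclidean_op_norm As * euclidean_op_norm A) +
     Num.sqrt d%:R / 2 * w_e (absA \* absAs) in
   let F2 :=
     2^-1 * (Num.sqrt (op_norm (\sum_(k < d) tuple_pow absAs 2 k)) *
             Num.sqrt (op_norm (\sum_(k < d) tuple_pow absA 2 k))) +
     Num.sqrt d%:R / 2 * w_e (absA \* absAs) in
   w_e A <= Num.sqrt F1 /\ Num.sqrt F1 = Num.sqrt F2).
Proof.
move=> As absA absAs w_e; split=> [t t01 E1 E2|F1 F2].
  split; first exact: (euclidean_op_radius_bound_abs norm_dot A t01).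
  have /andP[t0 t1] := t01; have t1' : 0 <= 1 - t by rewrite subr_ge0.
  have Es := euclidean_op_norm_pow_abs norm_dot As t1'.
  have E := euclidean_op_norm_pow_abs norm_dot A t0.
  by congr (Num.sqrt (2^-1 * (_ * _) + _)); [exact: Es|exact: E].
have Es := euclidean_op_norm_abs2 norm_dot As.
have E := euclidean_op_norm_abs2 norm_dot A.
have F12 : F1 = F2 by congr (2^-1 * (_ * _) + _); [exact: Es|exact: E].
split; last by rewrite F12.
exact: (euclidean_op_radius_bound_half norm_dot A).
Qed.
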